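(* Let $(\Gamma,\mathcal{G})$ be a relatively hyperbolic group and let $\partial\Gamma$ be its (Bowditch) boundary. Then the action of $\Gamma$ on $\partial\Gamma$ is expansive.
   Context: **Expansivity.** The action of a group $\Gamma$ on a compact space $K$ is *expansive* if there is a neighbourhood $U$ of the diagonal $\Delta\subset K\times K$ such that $\Delta=\bigcap_{\gamma\in\Gamma}\gamma U$ (diagonal action on $K\times K$). **Relatively hyperbolic groups.** A graph is a set of vertices with a set of edges (unordered pairs of vertices); edges have length 1. A circuit is a simplicial loop without self-intersection. A graph is *fine* if for every $L>0$ and every edge $e$, the set of circuits of length less than $L$ containing $e$ is finite. A group $\Gamma$ is *hyperbolic relative* to a family $\mathcal{G}$ of subgroups (one says $(\Gamma,\mathcal{G})$ is a relatively hyperbolic group) if it acts on a (connected) Gromov-hyperbolic fine graph $\mathcal{K}$ such that stabilizers of edges are finite, there are finitely many orbits of edges, and the stabilizers of the vertices of infinite valence are finitely generated and are exactly the elements of $\mathcal{G}$. Such a $\mathcal{K}$ is called a graph associated to $(\Gamma,\mathcal{G})$. **Boundary.** With $\mathcal{K}$ an associated graph, $\partial\Gamma=\partial\mathcal{K}\cup\mathcal{V}_\infty$, where $\partial\mathcal{K}$ is the Gromov boundary of $\mathcal{K}$ and $\mathcal{V}_\infty$ is the set of vertices of infinite valence. It carries Bowditch's topology, the subspace topology from $V(\mathcal{K})\cup\partial\mathcal{K}$, where $U\subset V(\mathcal{K})\cup\partial\mathcal{K}$ is open iff for each $a\in U$ there is a finite set $A$ of vertices such that $U$ contains every $b\in V(\mathcal{K})\cup\partial\mathcal{K}$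 for which every geodesic from $a$ to $b$ meets $A$ at most in $a$. This makes $\partial\Gamma$ a compact metrisable space on which $\Gamma$ acts by homeomorphisms. *)

(* Defs.v *)
From HB Require Import structures.
From mathcomp Require Import all_boot all_order all_algebra.
From mathcomp Require Import all_classical all_reals topology.

Set Implicit Arguments.
Unset Strict Implicit.
Unset Printing Implicit Defensive.

Import Order.TTheory GRing.Theory Num.Theory.

Local Open Scope classical_set_scope.
Local Open Scope nat_scope.

Record left_action (Gam : groupType) (X : Type) := LeftAction {
  act :> Gam -> X -> X;
  act1 : forall x, act 1%g x = x;
  actM : forall g h x, act (g * h)%g x = act g (act h x) }.

Definition diag_act (Gam : groupType) (X : Type) (a : left_action Gam X)
  (g : Gam) (p : X * X) : X * X := (a g p.1, a g p.2).

Definition expansive (Gam : groupType) (X : topologicalType)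
    (a : left_action Gam X) : Prop :=
  exists2 U : set (X * X), set_nbhs diagonal U &
    diagonal = \bigcap_(g in [set: Gam]) (diag_act a g @` U).

Definition subgroup (Gam : groupType) (H : set Gam) : Prop :=
  group_closed [in H].

Definition finitely_generated (Gam : groupType) (H : set Gam) : Prop :=
  exists2 S : set Gam, finite_set S & H = smallest (@subgroup Gam) S.

Record graph := Graph {
  vertex :> choiceType;
  adj : rel vertex;
  adj_sym : symmetric adj;
  adj_irr : irreflexive adj }.

Section GraphDefs.
Variable K : graph.
Implicit Types (x y z w : K) (c s t : nat -> K).

(* An edge is the two-element set of its endpoints. *)
Definition edges : set (set K) :=
  [set e | exists x y, adj x y /\ e = [set x; y]].

Definition infinite_valence x : Prop := infinite_set [set y | adj x y].

Definition walk_lengths x y : set nat :=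
  [set n | exists p : seq K, [/\ path (@adj K) x p, last x p = y & size p = n]].

Definition connected_graph : Prop := forall x y, walk_lengths x y !=set0.

(* 0 is a junk value, taken when x and y lie in different components. *)
Definition dist x y : nat :=
  xget 0 [set n | walk_lengths x y n /\ lbound (walk_lengths x y) n].

(* A circuit is listed as the cyclic sequence of its vertices. It is listed
   once for each starting point and orientation, hence finitely often, which
   does not affect fineness. *)
Definition circuit (c : seq K) : Prop := ucycle (@adj K) c /\ 2 < size c.

Definition circuit_edges (c : seq K) : set (set K) :=
  [set [set x; next c x] | x in [set` c]].

Definition fine : Prop := forall (L : nat) (e : set K), edges e ->
  finite_set [set c | [/\ circuit c, size c < L & circuit_edges c e]].

(* Twice the Gromov product of x and y based at w; the truncated subtraction
   is harmless in a connected graph, by the triangle inequality. *)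
Definition gromov_product2 w x y : nat := dist x w + dist y w - dist x y.

(* Gromov's four-point condition for the vertex set with the path metric;
   passing to the geometric realization only changes the constant. *)
Definition gromov_hyperbolic : Prop := exists delta : nat, forall w x y z,
  minn (gromov_product2 w x y) (gromov_product2 w y z)
    <= gromov_product2 w x z + delta.

(* The Gromov product of (s_i) and (t_j) tends to infinity as i, j do. A
   sequence converges to infinity when it is asymptotic to itself. *)
Definition asymptotic s t : Prop := forall (w : K) (M : nat),
  exists N : nat, forall i j, N <= i -> N <= j ->
    M <= gromov_product2 w (s i) (t j).

Definition ideal_class s : set (nat -> K) :=
  [set t | asymptotic t t /\ asymptotic s t].

(* As K need not be locally finite, the Gromov boundary is taken in its general
   form: sequences converging to infinity, up to being asymptotic. *)
Definition gromov_boundary : Type :=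
  set_type [set ideal_class s | s in [set s | asymptotic s s]].

Definition converges_to (s : nat -> K) (xi : gromov_boundary) : Prop :=
  set_val xi s.

Inductive completion : Type :=
  | Vertex of K
  | Ideal of gromov_boundary.

Definition is_segment (n : nat) c : Prop :=
  forall i j, i <= j <= n -> dist (c i) (c j) = j - i.

Definition is_ray c : Prop :=
  forall i j, i <= j -> dist (c i) (c j) = j - i.

Definition is_line (c : int -> K) : Prop :=
  forall i j : int, (i <= j)%R -> dist (c i) (c j) = `|j - i|%N.

(* S is the set of vertices of a geodesic from a to b. *)
Definition geodesic (a b : completion) (S : set K) : Prop :=
  match a, b with
  | Vertex x, Vertex y => exists n c,
      [/\ is_segment n c, c 0 = x, c n = y & S = [set c i | i in `I_n.+1]]
  | Vertex x, Ideal xi | Ideal xi, Vertex x => exists c,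
      [/\ is_ray c, c 0 = x, converges_to c xi & S = range c]
  | Ideal xi, Ideal eta => exists c : int -> K,
      [/\ is_line c, converges_to (fun n : nat => c (- Posz n)%R) xi,
          converges_to (fun n : nat => c (Posz n)) eta & S = range c]
  end.

Definition completion_open (U : set completion) : Prop :=
  forall a, U a -> exists2 A : set K, finite_set A &
    forall b, (forall S, geodesic a b S ->
                 forall x, S x -> A x -> Vertex x = a) -> U b.

Lemma completion_openT : completion_open setT.
Proof. by move=> a _; exists set0. Qed.

Lemma completion_openI : setI_closed completion_open.
Proof.
move=> U V oU oV a [/oU[A finA AU] /oV[B finB BV]].
exists (A `|` B); first by rewrite finite_setU.
move=> b abE; split; [apply: AU|apply: BV] => S abS x Sx Ax.
- by apply: abE abS _ Sx _; left.
- by apply: abE abS _ Sx _; right.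
Qed.

Lemma completion_open_bigU (I : Type) (f : I -> set completion) :
  (forall i, completion_open (f i)) -> completion_open (\bigcup_i f i).
Proof.
move=> of_ a [i _ /of_[A finA Af]]; exists A => // b abE.
by exists i => //; exact: Af.
Qed.

HB.instance Definition _ := gen_eqMixin completion.
HB.instance Definition _ := gen_choiceMixin completion.
HB.instance Definition _ := isOpenTopological.Build completion
  completion_openT completion_openI completion_open_bigU.

Definition boundary_points : set completion :=
  [set a | if a is Vertex x then infinite_valence x else True].

(* The coercion to set_type equips this with the subspace topology. *)
Definition bowditch_boundary : topologicalType := boundary_points.

End GraphDefs.

Record graph_action (Gam : groupType) (K : graph) := GraphAction {
  vertex_act :> left_action Gam K;
  adj_act : forall g x y, adj (vertex_act g x) (vertex_act g y) = adj x y }.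

Section RelativeHyperbolicity.
Variables (Gam : groupType) (K : graph) (a : graph_action Gam K).

Definition vertex_stabilizer (x : K) : set Gam := [set g | a g x = x].

Definition edge_stabilizer (e : set K) : set Gam := [set g | a g @` e = e].

Definition edge_orbit (e : set K) : set (set K) :=
  [set a g @` e | g in [set: Gam]].

Definition associated_graph (G : set (set Gam)) : Prop :=
  [/\ connected_graph K, gromov_hyperbolic K & fine K] /\
  [/\ forall e, edges e -> finite_set (edge_stabilizer e),
      finite_set (edge_orbit @` @edges K),
      forall x : K, infinite_valence x ->
        finitely_generated (vertex_stabilizer x) &
      G = [set vertex_stabilizer x | x in @infinite_valence K]].

End RelativeHyperbolicity.

Definition relatively_hyperbolic (Gam : groupType) (G : set (set Gam)) : Prop :=
  exists (K : graph) (a : graph_action Gam K), associated_graph a G.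

Section BoundaryAction.
Variables (Gam : groupType) (K : graph) (a : graph_action Gam K).
Implicit Types (g h : Gam) (x y w : K) (s t : nat -> K).

Lemma actVK g x : a g^-1%g (a g x) = x.
Proof. by rewrite -actM mulVg act1. Qed.

Lemma actKV g x : a g (a g^-1%g x) = x.
Proof. by rewrite -actM mulgV act1. Qed.

Lemma walk_lengths_act g x y : walk_lengths (a g x) (a g y) = walk_lengths x y.
Proof.
have sub h u v : walk_lengths u v `<=` walk_lengths (a h u) (a h v).
  move=> n [p [pp lp sp]]; exists (map (a h) p); split.
  - by rewrite path_map (eq_path (e' := @adj K)) // => z t /=; rewrite adj_act.
  - by rewrite last_map lp.
  - by rewrite size_map.
apply/seteqP; split; last exact: sub.
by have := sub g^-1%g (a g x) (a g y); rewrite !actVK.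
Qed.

Lemma dist_act g x y : dist (a g x) (a g y) = dist x y.
Proof. by rewrite /dist walk_lengths_act. Qed.

Lemma asymptotic_act g s t :
  asymptotic s t -> asymptotic (a g \o s) (a g \o t).
Proof.
move=> st w M; have [N HN] := st (a g^-1%g w) M; exists N => i j Ni Nj.
by rewrite -[w](actKV g) /gromov_product2 /= !dist_act; exact: HN.
Qed.

Lemma ideal_class_act g s :
  comp (a g) @` ideal_class s = ideal_class (a g \o s).
Proof.
have compK h t : t = a h \o (a h^-1%g \o t).
  by apply/funext => i /=; rewrite actKV.
apply/seteqP; split=> [_ [t [tt st] <-]|t [tt st]].
  by split; exact: asymptotic_act.
exists (a g^-1%g \o t); last by rewrite -compK.
split; first exact: asymptotic_act.
have -> : s = a g^-1%g \o (a g \o s) by apply/funext => i /=; rewrite actVK.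
exact: asymptotic_act.
Qed.

Lemma ideal_act_subproof g (xi : gromov_boundary K) :
  comp (a g) @` set_val xi \in
    [set ideal_class s | s in [set s : nat -> K | asymptotic s s]].
Proof.
apply/mem_set; have [s ss sE] := set_valP xi.
exists (a g \o s); first exact: asymptotic_act.
by rewrite -ideal_class_act sE.
Qed.

Definition ideal_act g (xi : gromov_boundary K) : gromov_boundary K :=
  exist (fun C => C \in _) _ (ideal_act_subproof g xi).

Definition completion_act g (p : completion K) : completion K :=
  match p with
  | Vertex x => Vertex (a g x)
  | Ideal xi => Ideal (ideal_act g xi)
  end.

Lemma infinite_valence_act g x :
  infinite_valence x -> infinite_valence (a g x).
Proof.
move=> infx finx; apply: infx.
apply: (@sub_finite_set _ _ (a g^-1%g @` [set y | adj (a g x) y])).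
  by move=> y xy; exists (a g y); [rewrite /= adj_act|rewrite actVK].
exact: finite_image.
Qed.

Lemma boundary_act_subproof g (p : bowditch_boundary K) :
  completion_act g (set_val p) \in @boundary_points K.
Proof.
have act_boundary q : boundary_points q -> boundary_points (completion_act g q).
  by case: q => [x|//]; exact: infinite_valence_act.
exact/mem_set/act_boundary/set_valP.
Qed.

Definition boundary_act g (p : bowditch_boundary K) : bowditch_boundary K :=
  exist (fun q => q \in _) _ (boundary_act_subproof g p).

Lemma completion_act1 p : completion_act 1%g p = p.
Proof.
case: p => [x|xi] /=; first by rewrite act1.
congr Ideal; apply/val_inj => /=.
by rewrite (_ : comp _ = id) ?image_id//; apply/funext => s; apply/funext => i;
  exact: act1.
Qed.

Lemma completion_actM g h p :
  completion_act (g * h)%g p = completion_act g (completion_act h p).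
Proof.
case: p => [x|xi] /=; first by rewrite actM.
congr Ideal; apply/val_inj => /=; rewrite image_comp.
congr (_ @` _); apply/funext => s; apply/funext => i; exact: actM.
Qed.

Lemma boundary_act1 p : boundary_act 1%g p = p.
Proof. by apply/val_inj; exact: completion_act1. Qed.

Lemma boundary_actM g h p :
  boundary_act (g * h)%g p = boundary_act g (boundary_act h p).
Proof. by apply/val_inj; exact: completion_actM. Qed.

Definition boundary_action : left_action Gam (bowditch_boundary K) :=
  LeftAction boundary_act1 boundary_actM.

End BoundaryAction.

(* Main.v *)
Require Import Defs.
From mathcomp Require Import all_boot all_order all_algebra.
From mathcomp Require Import all_classical all_reals topology.
From mathcomp Require Import zify.

Set Implicit Arguments.
Unset Strict Implicit.
Unset Printing Implicit Defensive.

Local Open Scope classical_set_scope.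
Local Open Scope nat_scope.

(** Take one edge in each of the finitely many orbits of edges, and let [U] be
    the set of pairs of boundary points such that no geodesic between them
    contains one of these edges. Two distinct points of the boundary are joined
    by a geodesic ([geodesic_exists]); it contains an edge, and the element of
    the group that moves this edge to its representative moves the pair out of
    [U]. What has to be seen is that [U] is a neighbourhood of the diagonal: every
    point has a neighbourhood such that no geodesic between two of its points
    contains a given edge ([edge_nbhd]).

    Fineness enters only through [finite_on_arc]: between two vertices there are
    finitely many simple paths of a given length. Together with hyperbolicity
    this acts as a substitute for local finiteness. If a geodesic passes close to
    [p] and later close to [q], then its vertices in between lie on a short simple
    path from [p] to [q] ([on_arc_between]), hence in a finite set. Limits of
    geodesics thus exist by Koenig's lemma, which gives rays and lines with
    prescribed ideal end points ([ray_from], [line_exists]). In the same way, if a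
    geodesic from [x] is followed, away from [x], by one that avoids [x], then its
    first edge is one of finitely many ([first_vertex_on_arc], [bounded_angle]).

    The topology is defined through sets attached to each point, which are not
    obviously open. The open sets used here are the [misses w f],
    made of the points that no geodesic from [w] reaches through [f]
    ([misses_open]). Near a vertex [x], geodesics from [w] have to go through [x];
    near an ideal point they have to follow a ray for a long time, and a limit of
    geodesics through [f] would be a ray through [f]. The neighbourhoods of
    [vertex_nbhd] and [ideal_nbhd] are finite intersections of such sets. *)

(** * A compactness lemma *)

(** The map [c] is the limit of the maps [s n] along an ultrafilter on the natural
    numbers: since [s n i] takes its values in a finite set, it is constant on a
    member of the ultrafilter. Rays are indexed by natural numbers and lines by
    integers, hence the arbitrary index type. *)
Lemma konig (I : eqType) (T : choiceType) (F : I -> set T) (s : nat -> I -> T) :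
  (forall i, finite_set (F i)) ->
  (forall i, exists N, forall n, N <= n -> F i (s n i)) ->
  exists c : I -> T, forall (J : seq I) N,
    exists2 n, N <= n & forall i, i \in J -> c i = s n i.
Proof.
move=> finF Fs; have [U [UU sub]] := ultraFilterLemma eventually_filter.
have PU : ProperFilter U := @ultra_proper _ _ UU.
have tail N : U [set n | N <= n] by apply: sub; exists N.
have ex i : exists v, U [set n | s n i = v].
  apply: contrapT => no.
  have avoid v : U (~` [set n | s n i = v]).
    by case: (in_ultra_setVsetC [set n | s n i = v] UU) => // h; case: no; exists v.
  have [N HN] := Fs i.
  have [l Fl] := (finite_seqP (F i)).1 (finF i).
  suff Ul : U [set n | s n i \notin l].
    have [n [/negP snl Nn]] := filter_ex (filterI Ul (tail N)).
    by apply: snl; have := HN n Nn; rewrite Fl.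
  elim: (l) => [|v l' IH]; first exact: filterS filterT.
  apply: filterS (filterI IH (avoid v)) => n [h1 h2] /=.
  by rewrite inE negb_or h1 andbT; apply/eqP.
have [c cU] := choice ex; exists c => J N.
suff /(fun h => filterI h (tail N))/filter_ex[n [h Nn]] :
  U [set n | forall i, i \in J -> c i = s n i] by exists n.
elim: J => [|j J IH]; first exact: filterS filterT.
apply: filterS (filterI IH (cU j)) => n [h1 h2] i; rewrite inE => /orP[/eqP ->//|].
exact: h1.
Qed.

(** * The path metric of a connected graph *)

Section FineHyperbolicGraph.
Variable K : graph.
Hypothesis connK : connected_graph K.
Implicit Types (x y z u v w p q : K) (c : nat -> K) (P Q : set K) (n L : nat).

Lemma dist_lengths x y :
  walk_lengths x y (dist x y) /\ lbound (walk_lengths x y) (dist x y).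
Proof.
have [n0 Hn0] := connK x y.
have ex : exists n, n \in walk_lengths x y by exists n0; apply/mem_set.
case: (ex_minnP ex) => m /set_mem Hm mmin.
apply: (@xgetPex _ 0 [set n | walk_lengths x y n /\ lbound (walk_lengths x y) n]).
by exists m; split=> // k /mem_set /mmin.
Qed.

Lemma dist_le_walk x s : path (@adj K) x s -> dist x (last x s) <= size s.
Proof.
move=> xs; have [_ lb] := dist_lengths x (last x s).
by apply: lb; exists s.
Qed.

Lemma distxx x : dist x x = 0.
Proof. by have := @dist_le_walk x [::] isT; rewrite /= leqn0 => /eqP. Qed.

Lemma dist0_eq x y : dist x y = 0 -> x = y.
Proof.
move=> d0; have [[s [_ ls sz]] _] := dist_lengths x y.
by move: sz ls; rewrite d0 => /size0nil ->.
Qed.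

Lemma dist_triangle y x z : dist x z <= dist x y + dist y z.
Proof.
have [[s [ps ls <-]] _] := dist_lengths x y.
have [[t [pt lt <-]] _] := dist_lengths y z.
have := @dist_le_walk x (s ++ t); rewrite cat_path last_cat ls lt size_cat.
by apply; rewrite ps.
Qed.

Lemma distC_le x y : dist x y <= dist y x.
Proof.
have [[s [ps ls <-]] _] := dist_lengths y x.
case/lastP: s ps ls => [_ /= ->|s z ps]; first by rewrite distxx.
rewrite last_rcons => <-.
have := @dist_le_walk z (rev (belast y (rcons s z))).
rewrite size_rev size_belast belast_rcons rev_cons last_rcons; apply.
have := rev_path (@adj K) y (rcons s z); rewrite last_rcons belast_rcons.
by rewrite rev_cons => ->; rewrite (eq_path (e' := @adj K)) // => u v; rewrite /= adj_sym.
Qed.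

Lemma distC x y : dist x y = dist y x.
Proof. by apply/eqP; rewrite eqn_leq !distC_le. Qed.

Lemma adj_dist x y : adj x y -> dist x y = 1.
Proof.
move=> xy; have := @dist_le_walk x [:: y]; rewrite /= xy => /(_ isT).
case E: (dist x y) => [|[]] // _.
by move/dist0_eq: E xy => ->; rewrite adj_irr.
Qed.

Lemma dist_adj x y : dist x y = 1 -> adj x y.
Proof.
move=> d1; have [[s [ps ls sz]] _] := dist_lengths x y.
by case: s ps ls sz => [|z [|v s]] /=; rewrite d1 // andbT => xz <-.
Qed.

(** That is, [y] lies on some geodesic from [x] to [z]. Geodesics are mostly used
    through this relation, which turns hyperbolic geometry into arithmetic. *)
Definition between x y z : Prop := dist x y + dist y z = dist x z.

Lemma betweenC x y z : between x y z -> between z y x.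
Proof. by rewrite /between (distC z) (distC y x) (distC z); lia. Qed.

Lemma lazy_dist c i j : (forall k, i <= k < j -> dist (c k) (c k.+1) <= 1) ->
  i <= j -> dist (c i) (c j) <= j - i.
Proof.
elim: j => [|j IH] st ij; first by rewrite (_ : i = 0) ?distxx//; lia.
have [->|ij'] : i = j.+1 \/ i <= j by lia.
  by rewrite distxx.
have := IH (fun k kj => st k ltac:(lia)) ij'.
have := st j ltac:(lia); have := dist_triangle (c j) (c i) (c j.+1); lia.
Qed.

Lemma lazy_segment n c : (forall k, k < n -> dist (c k) (c k.+1) <= 1) ->
  dist (c 0) (c n) = n -> is_segment n c.
Proof.
move=> st d0n i j ijn.
have := @lazy_dist c 0 i (fun k kj => st k ltac:(lia)) ltac:(lia).
have := @lazy_dist c i j (fun k kj => st k ltac:(lia)) ltac:(lia).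
have := @lazy_dist c j n (fun k kj => st k ltac:(lia)) ltac:(lia).
have := dist_triangle (c i) (c 0) (c n); have := dist_triangle (c j) (c i) (c n).
lia.
Qed.

Lemma segment_exists x y :
  exists c, [/\ c 0 = x, c (dist x y) = y & is_segment (dist x y) c].
Proof.
have [[s [ps ls sz]] _] := dist_lengths x y.
exists (nth y (x :: s)); split => //.
  by rewrite -sz -last_nth.
apply: lazy_segment => [k kn|]; last by rewrite -sz -(last_nth y) ls sz.
by move/(pathP y): ps => /(_ k); rewrite sz => /(_ kn) /adj_dist /= ->.
Qed.

(** * Walks inside a set of vertices *)

(** Keeping track of a set containing the walk is what allows one to say that a
    detour avoids a vertex, or that a shortened walk still visits one. *)
Definition walk_in P x y n : Prop := exists s,
  [/\ path (@adj K) x s, last x s = y, size s <= n & forall z, z \in x :: s -> P z].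

Lemma walk_in_refl P x n : P x -> walk_in P x x n.
Proof. by move=> Px; exists [::]; split=> // z; rewrite inE => /eqP ->. Qed.

Lemma walk_in_cat P x y z n n' : walk_in P x y n -> walk_in P y z n' ->
  walk_in P x z (n + n').
Proof.
move=> [s [ps ls sz Ps]] [t [pt lt tz Pt]]; exists (s ++ t); split.
- by rewrite cat_path ps ls.
- by rewrite last_cat ls.
- by rewrite size_cat leq_add.
- move=> v; rewrite -cat_cons mem_cat => /orP[/Ps//|vt].
  by apply: Pt; rewrite inE vt orbT.
Qed.

Lemma walk_in_sub P Q x y n n' : P `<=` Q -> n <= n' ->
  walk_in P x y n -> walk_in Q x y n'.
Proof.
move=> PQ nn [s [ps ls sz Ps]]; exists s; split=> //; first exact: leq_trans nn.
by move=> z /Ps /PQ.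
Qed.

Lemma segment_walk_in n c : (forall k, k < n -> dist (c k) (c k.+1) = 1) ->
  walk_in [set c i | i in `I_n.+1] (c 0) (c n) n.
Proof.
elim: n => [|n IH] st; first by apply: walk_in_refl; exists 0.
have w1 : walk_in [set c i | i in `I_n.+2] (c 0) (c n) n.
  apply: walk_in_sub (IH (fun k kn => st k (ltnW kn))) => // _ [i /= ilt <-].
  by exists i => //=; lia.
rewrite -[X in walk_in _ _ _ X]addn1; apply: walk_in_cat w1 _.
exists [:: c n.+1]; split=> //=; first by rewrite dist_adj// st.
by move=> z; rewrite !inE => /orP[]/eqP ->; [exists n|exists n.+1] => //=; lia.
Qed.

Lemma geodesic_walk x y : walk_in [set z | between x z y] x y (dist x y).
Proof.
have [c [c0 cn seg]] := segment_exists x y.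
have : walk_in [set c i | i in `I_(dist x y).+1] (c 0) (c (dist x y)) (dist x y).
  by apply: segment_walk_in => k kn; rewrite seg; lia.
rewrite c0 cn; apply: walk_in_sub => // _ [i /= ilt <-].
have := seg 0 i; have := seg i (dist x y); rewrite c0 cn /between; lia.
Qed.

Lemma walk_ivt (f : K -> nat) k x s : path (@adj K) x s ->
  (forall u v, adj u v -> f u <= (f v).+1) ->
  k <= f x -> f (last x s) <= k -> exists2 z, z \in x :: s & f z = k.
Proof.
move=> ps lip; elim: s x ps => [|y s IH] x /=.
  by move=> _ kx xk; exists x; [rewrite mem_head|lia].
move=> /andP[xy ys] kx fk; have := lip _ _ xy.
case: (ltngtP k (f x)) kx => // [kx|kx] _ xly.
  have [z zs fz] := IH y ys ltac:(lia) fk.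
  by exists z => //; rewrite inE zs orbT.
by exists x; [rewrite mem_head|].
Qed.

Definition on_arc L x y : set K := [set z | exists s,
  [/\ path (@adj K) x s, last x s = y, uniq (x :: s), size s <= L & z \in x :: s]].

Lemma walk_arc P x y L : walk_in P x y L ->
  exists s, [/\ path (@adj K) x s, last x s = y, uniq (x :: s), size s <= L
    & forall z, z \in x :: s -> P z].
Proof.
move=> [s [ps ls sz Ps]]; move: ls; case: (shortenP ps) => s' ps' us' sub ls.
exists s'; split=> //.
- by apply: leq_trans sz; apply: uniq_leq_size sub; case/andP: us'.
- move=> z; rewrite inE => /orP[/eqP ->|/sub zs]; apply: Ps.
    exact: mem_head.
  by rewrite inE zs orbT.
Qed.

(** The walk from [p] to [p'], along the geodesic through [x] to [q'] and on to
    [q] meets the level of [x] for the distance to [q'] only in [x]; since it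
    starts above that level and ends below it, no shortening can skip [x]. *)
Lemma on_arc_between C1 C2 p q p' q' x : dist p p' <= C1 -> dist q q' <= C2 ->
  between p' x q' -> C1 < dist p' x -> C2 < dist x q' ->
  on_arc (C1 + C2 + dist p' q') p q x.
Proof.
move=> pC qC b C1x C2x.
pose P := [set v | dist v q' = dist x q' -> v = x].
have w1 : walk_in P p p' C1.
  apply: (@walk_in_sub _ _ _ _ _ _ _ pC (geodesic_walk p p')) => v /= bv e; exfalso.
  have := dist_triangle v p' q'; have := distC p' v.
  move: b bv; rewrite /between; lia.
have w2 : walk_in P p' x (dist p' x).
  apply: walk_in_sub (leqnn _) (geodesic_walk p' x) => v /= bv e.
  apply: dist0_eq; have := dist_triangle v p' q'.
  move: b bv; rewrite /between; lia.
have w3 : walk_in P x q' (dist x q').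
  apply: walk_in_sub (leqnn _) (geodesic_walk x q') => v /= bv e.
  apply/esym/dist0_eq; move: bv; rewrite /between; lia.
have w4 : walk_in P q' q C2.
  have qC' : dist q' q <= C2 by rewrite distC.
  apply: (@walk_in_sub _ _ _ _ _ _ _ qC' (geodesic_walk q' q)) => v /= bv e; exfalso.
  have := distC q' v; move: bv; rewrite /between; lia.
have w := walk_in_cat (walk_in_cat w1 w2) (walk_in_cat w3 w4).
have [s [ps ls us sz Ps]] := walk_arc w.
have [|||z zs zx] := @walk_ivt (fun v => dist v q') (dist x q') p s ps.
- by move=> u v uv; have := dist_triangle v u q'; rewrite (adj_dist uv).
- have := dist_triangle p p' q'; have := distC p p'; move: b; rewrite /between; lia.
- by rewrite ls; lia.
exists s; split=> //; last by have <- : z = x by exact: Ps.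
by move: b sz; rewrite /between; lia.
Qed.

Lemma on_arc_first L P x y u : adj x y -> walk_in P y u L -> ~ P x ->
  on_arc L.+1 x u y.
Proof.
move=> xy /walk_arc[s [ps ls us sz Ps]] Px.
exists (y :: s); split=> //=.
- by rewrite xy.
- by apply/andP; split=> //; apply/negP => /Ps.
- by rewrite !inE eqxx orbT.
Qed.

Lemma on_arc_last L x y : dist x y <= L -> on_arc L x y y.
Proof.
move=> xyL; have /walk_arc[s [ps ls us sz _]] := geodesic_walk x y.
exists s; split=> //; first exact: leq_trans xyL.
by rewrite -ls mem_last.
Qed.

(** * Fineness makes short arcs finite in number *)

(** Follow the second arc, which starts with [y], up to the first vertex of [s]
    that it contains, and come back to [x] along [s]: this is a circuit unless
    both pieces consist of the edge from [x] to [y]. By fineness it leaves finitely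
    many possibilities for the first vertex of [s]. *)
Lemma two_arcs_circuit x y z s t : path (@adj K) x s -> path (@adj K) x (y :: t) ->
  uniq (x :: s) -> uniq (x :: y :: t) -> last x s = z -> last y t = z -> x <> z ->
  head x s = y \/ exists c : seq K, [/\ circuit c, size c <= (size s + size t).+1,
     circuit_edges c [set x; y] & head x s \in c].
Proof.
move=> ps pt us ut ls lt xz.
have hs : has (mem (y :: t)) s.
  apply/hasP; exists z; last by rewrite /= -lt mem_last.
  by case: s ls {ps us} => [/xz//|v s] <- /=; rewrite mem_last.
move: ps us ls; case: (split_find hs) => v s1 s2 + hs1; rewrite inE => vt.
have [t1 [t2 et]] : exists t1 t2, y :: t = rcons t1 v ++ t2.
  by case/splitPr: vt => t1 t2; exists t1, t2; rewrite cat_rcons.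
rewrite et in pt ut; move=> ps us ls.
have hd : y = head v t1 by move: et; case: t1 {pt ut} => [[->]|a t1 [-> _]].
have hx : head x (rcons s1 v ++ s2) = head v s1 by case: s1 {hs1 ps us ls}.
rewrite hx.
case: (eqVneq (nilp s1 && nilp t1) true) => [/andP[/nilP -> /nilP t10]|nil].
  by left; rewrite hd t10.
(* The vertex [v] is the first one of [s] on the other arc. *)
right; exists (x :: rcons t1 v ++ rev s1).
have ut' : uniq (x :: rcons t1 v).
  by move: ut; rewrite -cat_cons cat_uniq => /andP[].
have us' : uniq (x :: rcons s1 v).
  by move: us; rewrite -cat_cons cat_uniq => /andP[].
have unt : uniq (x :: rcons t1 v ++ rev s1).
  rewrite -cat_cons cat_uniq ut' rev_uniq /=.
  move: us'; rewrite /= rcons_uniq mem_rcons inE negb_or => /and3P[/andP[xv xs1] vs1 ->].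
  rewrite andbT; apply/hasPn => w; rewrite mem_rev => ws1 /=.
  rewrite inE negb_or mem_rcons inE negb_or.
  apply/and3P; split; try by apply: contraNneq vs1 => <-.
  - by apply: contraNneq xs1 => <-.
  - apply/negP => wt1; move/hasPn: hs1 => /(_ _ ws1) /=.
    by rewrite et mem_cat mem_rcons inE wt1 orbT.
split.
- split; last first.
    rewrite /= size_cat size_rcons size_rev; move: nil; case: s1 {hs1 ps us ls us' hx unt} => [|? ?];
      case: t1 {pt ut ut' et hd} => [|? ?] //=; lia.
  apply/andP; split=> //; rewrite /cycle rcons_cat cat_path last_rcons.
  move: pt; rewrite cat_path => /andP[-> _] /=.
  move: ps; rewrite cat_path => /andP[ps1 _].
  have := rev_path (@adj K) x (rcons s1 v); rewrite last_rcons belast_rcons.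
  rewrite rev_cons => ->; rewrite (eq_path (e' := @adj K)) //.
  by move=> a b /=; rewrite adj_sym.
- have := congr1 size et; rewrite /= !size_cat !size_rcons size_rev; clear; lia.
- exists x; first by rewrite /= mem_head.
  by rewrite hd; case: (t1) => [|a t1'] /=; rewrite eqxx.
- rewrite inE mem_cat mem_rcons mem_rev inE.
  by case: (s1) => [|a s1'] /=; rewrite ?eqxx ?mem_head ?orbT.
Qed.

Hypothesis fineK : Defs.fine K.

Definition arcs L x y : set (seq K) := [set s |
  [/\ path (@adj K) x s, last x s = y, uniq (x :: s) & size s <= L]].

(** By induction on the length, after a comparison with one fixed arc from [x] to
    [y], which leaves finitely many choices for the first step. *)
Lemma finite_arcs L x y : finite_set (arcs L x y).
Proof.
elim: L x => [|L IH] x.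
  apply: (@sub_finite_set _ _ [set [::]]); last exact: finite_set1.
  by move=> s [_ _ _]; rewrite leqn0 => /nilP.
case: (pselect (x = y)) => [->|xy].
  apply: (@sub_finite_set _ _ [set [::]]); last exact: finite_set1.
  by move=> [|z s] [_ /= ls us _] //; case/andP: us; rewrite -{1}ls mem_last.
have /walk_arc[[|v t] [pt lt ut szt _]] := geodesic_walk x y; first by [].
pose M := (L + size t).+3.
pose C := [set c : seq K | [/\ circuit c, size c < M & circuit_edges c [set x; v]]].
have finC : finite_set C.
  by apply: fineK; exists x, v; split=> //; case/andP: pt.
pose X := v |` \bigcup_(c in C) [set` c].
have finX : finite_set X.
  rewrite finite_setU; split; first exact: finite_set1.
  by apply: bigcup_finite => // c _; exact: finite_seq.
apply: (@sub_finite_set _ _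
   ([set [::]] `|` \bigcup_(z in X) (cons z @` arcs L z y))).
  move=> [|z s] [ps ls us sz]; first by left.
  right; exists z; last first.
    exists s => //; move: ps us sz => /= /andP[_ ps] /andP[_ us] sz; by split.
  case: (two_arcs_circuit ps pt us ut ls lt xy) => [/= ->|[c [cc csz ce zc]]].
    by left.
  right; exists c => //; split=> //.
  by move: csz sz; rewrite /M /=; lia.
rewrite finite_setU; split; first exact: finite_set1.
apply: bigcup_finite => // z _; exact: finite_image.
Qed.

Lemma finite_on_arc L x y : finite_set (on_arc L x y).
Proof.
apply: (@sub_finite_set _ _ (\bigcup_(s in arcs L x y) [set` x :: s])).
  by move=> z [s [ps ls us sz zs]]; exists s.
by apply: bigcup_finite => [|s _]; [exact: finite_arcs|exact: finite_seq].
Qed.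

(** * Hyperbolicity *)

Variable delta : nat.
Hypothesis hypK : forall w x y z : K,
  minn (gromov_product2 w x y) (gromov_product2 w y z)
    <= gromov_product2 w x z + delta.
Implicit Types (s t : nat -> K) (b : completion K) (xi eta : gromov_boundary K).

Local Notation gp := (@gromov_product2 K).

Lemma gp_dist w x y : gp w x y + dist x y = dist w x + dist w y.
Proof.
have := dist_triangle w x y; rewrite /gromov_product2.
rewrite (distC x w) (distC y w); lia.
Qed.

Lemma gpC w x y : gp w x y = gp w y x.
Proof. by rewrite /gromov_product2 (distC y x) addnC. Qed.

Lemma gp_le w x y : gp w x y <= 2 * dist w x.
Proof. have := gp_dist w x y; have := dist_triangle x w y; lia. Qed.

Lemma gp_base w w' x y : gp w x y <= gp w' x y + 2 * dist w w'.
Proof.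
have := gp_dist w x y; have := gp_dist w' x y.
have := dist_triangle w' w x; have := dist_triangle w' w y; lia.
Qed.

Lemma four_point x y z w : dist x z + dist y w <=
  maxn (dist x y + dist z w) (dist y z + dist x w) + delta.
Proof.
have := hypK w x y z; have := gp_dist w x y; have := gp_dist w x z.
have := gp_dist w y z; rewrite (distC z w) (distC x w) (distC y w); lia.
Qed.

(** Seen from [x], the doubled Gromov product of two vertices of one geodesic
    from [x] is twice the smaller of their distances to [x]; hyperbolicity applied
    to [u], [y], [z], [v] then bounds that of [u] and [v] from below. *)
Lemma fellow_travel x y z u v : between x u y -> between x v z ->
  dist x u = dist x v -> 2 * dist x u <= gp x y z -> dist u v <= 2 * delta.
Proof.
move=> bu bv uv ut.
have := hypK x u y z; have := hypK x u z v.
have := gp_dist x u y; have := gp_dist x v z; have := gp_dist x u v.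
rewrite (gpC x z v); move: bu bv; rewrite /between; lia.
Qed.

(** * Sequences converging to a point of the completion *)

Lemma asymptotic_at w s t :
  (forall M, exists N, forall i j, N <= i -> N <= j -> M <= gp w (s i) (t j)) ->
  asymptotic s t.
Proof.
move=> st w' M; have [N HN] := st (M + 2 * dist w w').
exists N => i j Ni Nj; have := HN i j Ni Nj; have := gp_base w w' (s i) (t j); lia.
Qed.

Lemma asymptotic_sym s t : asymptotic s t -> asymptotic t s.
Proof.
move=> st w M; have [N HN] := st w M; exists N => i j Ni Nj.
by rewrite gpC; exact: HN.
Qed.

Lemma asymptotic_trans t s r : asymptotic s t -> asymptotic t r -> asymptotic s r.
Proof.
move=> st tr w M; have [N HN] := st w (M + delta); have [N' HN'] := tr w (M + delta).
exists (maxn N N') => i j Ni Nj.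
have := HN i (maxn N N') ltac:(lia) ltac:(lia).
have := HN' (maxn N N') j ltac:(lia) ltac:(lia).
have := hypK w (s i) (t (maxn N N')) (r j); lia.
Qed.

Lemma converges_class xi :
  exists2 s, asymptotic s s & forall t, converges_to t xi <-> ideal_class s t.
Proof. by have [s ss E] := set_valP xi; exists s => // t; rewrite E. Qed.

Lemma converges_exists xi : exists s, converges_to s xi.
Proof. by have [s ss sE] := converges_class xi; exists s; apply/sE. Qed.

Lemma converges_self s xi : converges_to s xi -> asymptotic s s.
Proof. by have [s0 _ E] := converges_class xi => /E[]. Qed.

Lemma converges_asymptotic s t xi :
  converges_to s xi -> converges_to t xi -> asymptotic s t.
Proof.
have [s0 _ E] := converges_class xi => /E[_ s0s] /E[_ s0t].
exact: asymptotic_trans (asymptotic_sym s0s) s0t.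
Qed.

Lemma asymptotic_converges s t xi :
  converges_to s xi -> asymptotic s t -> converges_to t xi.
Proof.
have [s0 _ E] := converges_class xi => /E[_ s0s] st; apply/E; split.
  exact: asymptotic_trans (asymptotic_sym st) st.
exact: asymptotic_trans s0s st.
Qed.

Lemma converges_unique s xi eta :
  converges_to s xi -> converges_to s eta -> xi = eta.
Proof.
move=> sxi seta; apply/val_inj/seteqP; split=> t h.
  exact: asymptotic_converges seta (converges_asymptotic sxi h).
exact: asymptotic_converges sxi (converges_asymptotic seta h).
Qed.

Lemma converges_close C N0 s t xi : converges_to s xi ->
  (forall i, N0 <= i -> dist (s i) (t i) <= C) -> converges_to t xi.
Proof.
move=> sxi st; apply: (asymptotic_converges sxi) => w M.
have [N HN] := converges_self sxi w (M + 2 * C).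
exists (maxn N N0) => i j Ni Nj.
have := HN i j ltac:(lia) ltac:(lia); have := st j ltac:(lia).
have := gp_dist w (s i) (s j); have := gp_dist w (s i) (t j).
have := dist_triangle (s j) (s i) (t j); have := dist_triangle (t j) w (s j).
rewrite (distC (t j) (s j)); lia.
Qed.

Lemma converges_reindex s t xi : converges_to s xi ->
  (forall N, exists N', forall i, N' <= i -> exists2 j, N <= j & t i = s j) ->
  converges_to t xi.
Proof.
move=> sxi st; apply: (asymptotic_converges sxi) => w M.
have [N HN] := converges_self sxi w M; have [N' HN'] := st N.
exists (maxn N N') => i j Ni Nj.
have [j' Nj' ->] := HN' j ltac:(lia); apply: HN => //; lia.
Qed.

Definition tends_to b s : Prop :=
  match b with
  | Vertex y => exists N, forall i, N <= i -> s i = y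
  | Ideal xi => converges_to s xi
  end.

(** For an ideal limit the product eventually exceeds every [M]; for a vertex it
    equals the doubled distance. The minimum covers both cases, so that limits of
    both kinds can be treated alike. *)
Lemma tends_to_agree b s t w M : tends_to b s -> tends_to b t ->
  exists N, forall i j, N <= i -> N <= j ->
    minn M (2 * dist w (s i)) <= gp w (s i) (t j).
Proof.
case: b => [y|xi] /=.
  move=> [N HN] [N' HN']; exists (maxn N N') => i j Ni Nj.
  rewrite HN ?HN'; try lia.
  by have := gp_dist w y y; rewrite distxx; lia.
move=> sxi txi; have [N HN] := converges_asymptotic sxi txi w M.
by exists N => i j Ni Nj; have := HN i j Ni Nj; lia.
Qed.

(** * Geodesics issued from a vertex *)

(** The map is made constant once it has reached a vertex [b], so that it tends to
    [b] in all cases. *)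
Definition geodesic_from x b c : Prop :=
  c 0 = x /\ match b with
  | Vertex y => is_segment (dist x y) c /\ forall i, dist x y <= i -> c i = y
  | Ideal xi => is_ray c /\ converges_to c xi
  end.

Section GeodesicFrom.
Variables (x : K) (b : completion K) (c : nat -> K).
Hypothesis xbc : geodesic_from x b c.

Lemma geodesic_from0 : c 0 = x.
Proof. by case: xbc. Qed.

Lemma geodesic_from_tends : tends_to b c.
Proof. by case: b xbc => [y|xi] [_ [? ?]] //; exists (dist x y). Qed.

Lemma geodesic_from_between i j k : i <= j <= k -> between (c i) (c j) (c k).
Proof.
rewrite /between; case: b xbc => [y|xi] [_ [seg end_]] ijk; last first.
  by rewrite !seg; lia.
have clamp m : c m = c (minn m (dist x y)).
  by case: (leqP (dist x y) m) => // ym; rewrite !end_.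
rewrite (clamp i) (clamp j) (clamp k) !seg; lia.
Qed.

Lemma geodesic_from_end i : dist x (c i) = i \/ Vertex (c i) = b.
Proof.
have c0 := geodesic_from0.
case: b xbc => [y|xi] [_ [seg end_]]; last by left; rewrite -c0 seg ?subn0.
case: (leqP (dist x y) i) => [yi|iy]; first by right; rewrite end_.
left; rewrite -{1}c0 seg ?subn0//; lia.
Qed.

Lemma geodesic_from_le i j : i <= j -> dist (c i) (c j) <= j - i.
Proof.
move=> ij; case: b xbc => [y|xi] [_ [seg end_]]; last by rewrite seg.
have clamp m : c m = c (minn m (dist x y)).
  by case: (leqP (dist x y) m) => // ym; rewrite !end_.
rewrite (clamp i) (clamp j) !seg; lia.
Qed.

Lemma geodesic_from_at k m : k <= dist x (c m) -> dist x (c k) = k.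
Proof.
have c0 := geodesic_from0.
case: b xbc => [y|xi] [_ [seg end_]] km; last by rewrite -c0 seg ?subn0.
have {km} ky : k <= dist x y.
  case: (leqP (dist x y) m) km => ym; first by rewrite end_.
  by rewrite -{1}c0 seg; lia.
by rewrite -{1}c0 seg ?subn0.
Qed.

Lemma geodesic_from_norm i : c (dist x (c i)) = c i.
Proof.
case: (geodesic_from_end i) => [-> //|].
have := geodesic_from_le (leq0n i); rewrite geodesic_from0 subn0 => le.
case: b xbc => [y|xi] // [_ [seg end_]] [ciy].
by rewrite ciy end_.
Qed.

(** Far terms of [s] and of [c] have a large Gromov product at [x], so [z] lies
    almost between [x] and far vertices of [c] as well; the vertex of [c] at the
    distance of [z] from [x] is then close to [z]. *)
Lemma near_geodesic_from s z e : tends_to b s ->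
  (forall N, exists2 i, N <= i & dist x z + dist z (s i) <= dist x (s i) + e) ->
  exists j, dist z (c j) <= e + 2 * delta.
Proof.
move=> sb az.
have [N HN] := tends_to_agree x (2 * dist x z) sb geodesic_from_tends.
have [i Ni zi] := az N; have := HN i N Ni (leqnn N) => agr.
have h1 := gp_dist x z (s i); have h2 := gp_le x (s i) z.
have h3 := hypK x z (s i) (c N); rewrite (gpC x (s i) z) in h2.
have h4 := gp_dist x z (c N).
case: (leqP (dist x z) (dist x (c N))) => zc; last first.
  by exists N; have := gp_le x (c N) z; rewrite (gpC x (c N) z); lia.
exists (dist x z).
have cz := geodesic_from_at zc.
have := geodesic_from_le (leq0n N); rewrite geodesic_from0 subn0 => le.
have := @geodesic_from_between 0 (dist x z) N ltac:(lia).
rewrite /between geodesic_from0 => bz.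
have := hypK x z (c N) (c (dist x z)).
have := gp_dist x (c N) (c (dist x z)); have := gp_dist x z (c (dist x z)).
rewrite (distC (c N)); lia.
Qed.

End GeodesicFrom.

Lemma geodesic_fromP x b S :
  geodesic (Vertex x) b S <-> exists2 c, geodesic_from x b c & S = range c.
Proof.
case: b => [y|xi] /=; last first.
  split=> [[c [ray c0 cxi ->]]|[c [c0 [ray cxi]] ->]].
    by exists c.
  by exists c.
split=> [[n [c [seg c0 cn ->]]]|[c [c0 [seg end_]] ->]].
  have dn : dist x y = n by rewrite -c0 -cn seg ?subn0// leqnn.
  exists (fun i => c (minn i n)); first split.
  - by rewrite min0n.
  - by rewrite dn; split=> [i j ijn|i ni]; rewrite ?seg -?cn; try congr c; lia.
  - apply/seteqP; split=> [_ [i /= ilt <-]|_ [i _ <-]].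
      by exists i => //; congr c; lia.
    by exists (minn i n) => //=; lia.
exists (dist x y), c; split=> //; first exact: end_.
apply/seteqP; split=> [_ [i _ <-]|_ [i /= ilt <-]]; last by exists i.
case: (leqP (dist x y) i) => yi; first by exists (dist x y) => //=; rewrite !end_.
by exists i => //=; lia.
Qed.

Lemma geodesicC (q r : completion K) S : geodesic q r S -> geodesic r q S.
Proof.
case: q r => [x|xi] [y|eta] //=.
  move=> [n [c [seg c0 cn ->]]]; exists n, (fun i => c (n - i)); split.
  - by move=> i j ijn; rewrite distC seg; lia.
  - by rewrite subn0.
  - by rewrite subnn.
  apply/seteqP; split=> _ [i /= ilt <-]; exists (n - i) => //=; try lia.
  by congr c; lia.
move=> [c [line cxi ceta ->]]; exists (fun i : int => c (- i)%R); split.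
- by move=> i j ij; rewrite distC line; [congr absz|]; lia.
- by apply: (converges_reindex ceta) => N; exists N => i Ni; exists i => //; congr c; lia.
- by [].
- by apply/seteqP; split=> _ [i _ <-]; exists (- i)%R => //; congr c; lia.
Qed.

(** This reduces the geodesics between arbitrary points of the completion, for
    which there are four cases, to geodesics issued from a vertex. *)
Lemma geodesic_split (q r : completion K) S u : geodesic q r S -> S u ->
  exists c1 c2, [/\ geodesic_from u q c1, geodesic_from u r c2,
    forall i j, between (c1 i) u (c2 j) & S = range c1 `|` range c2].
Proof.
case: q r => [x|xi] [y|eta] /=.
- move=> [n [c [seg c0 cn ->]]] [k /= kn <-].
  have dx : dist (c k) x = k by rewrite distC -c0 seg; lia.
  have dy : dist (c k) y = n - k by rewrite -cn seg; lia.
  exists (fun i => c (k - i)), (fun i => c (minn (k + i) n)); split.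
  + split; first by rewrite subn0.
    rewrite dx; split=> [i j ijk|i ki]; first by rewrite distC seg; lia.
    by rewrite -c0; congr c; lia.
  + split; first by congr c; lia.
    rewrite dy; split=> [i j ijk|i ki]; first by rewrite seg; lia.
    by rewrite -cn; congr c; lia.
  + by move=> i j; rewrite /between !seg; lia.
  + apply/seteqP; split=> [_ [i /= ilt <-]|_ [] [i _ <-]].
    * case: (leqP i k) => ik; [left; exists (k - i) => //|right; exists (i - k) => //];
        congr c; lia.
    * by exists (k - i) => //=; lia.
    * by exists (minn (k + i) n) => //=; lia.
- move=> [c [ray c0 ceta ->]] [k _ <-].
  have dx : dist (c k) x = k by rewrite distC -c0 ray; lia.
  exists (fun i => c (k - i)), (fun i => c (k + i)); split.
  + split; first by rewrite subn0.
    rewrite dx; split=> [i j ijk|i ki]; first by rewrite distC ray; lia.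
    by rewrite -c0; congr c; lia.
  + split; first by rewrite addn0.
    split=> [i j ij|]; first by rewrite ray; lia.
    by apply: (converges_reindex ceta) => N; exists N => i Ni; exists (k + i) => //; lia.
  + by move=> i j; rewrite /between !ray; lia.
  + apply/seteqP; split=> [_ [i _ <-]|_ [] [i _ <-]].
    * case: (leqP i k) => ik; [left; exists (k - i) => //|right; exists (i - k) => //];
      congr c; lia.
    * by exists (k - i).
    * by exists (k + i).
- move=> [c [ray c0 ceta ->]] [k _ <-].
  have dx : dist (c k) y = k by rewrite distC -c0 ray; lia.
  exists (fun i => c (k + i)), (fun i => c (k - i)); split.
  + split; first by rewrite addn0.
    split=> [i j ij|]; first by rewrite ray; lia.
    by apply: (converges_reindex ceta) => N; exists N => i Ni; exists (k + i) => //; lia.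
  + split; first by rewrite subn0.
    rewrite dx; split=> [i j ijk|i ki]; first by rewrite distC ray; lia.
    by rewrite -c0; congr c; lia.
  + by move=> i j; apply: betweenC; rewrite /between !ray; lia.
  + apply/seteqP; split=> [_ [i _ <-]|_ [] [i _ <-]].
    * case: (leqP i k) => ik; [right; exists (k - i) => //|left; exists (i - k) => //];
      congr c; lia.
    * by exists (k + i).
    * by exists (k - i).
- move=> [c [line cxi ceta ->]] [k _ <-].
  exists (fun i : nat => c (k - Posz i)%R), (fun i : nat => c (k + Posz i)%R); split.
  + split; first by congr c; lia.
    split=> [i j ij|]; first by rewrite distC line; lia.
    apply: (converges_reindex cxi) => N; exists (N + `|k|%N) => i Ni.
    by exists (absz (k - Posz i)%R); [|congr c]; lia.
  + split; first by congr c; lia.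
    split=> [i j ij|]; first by rewrite line; lia.
    apply: (converges_reindex ceta) => N; exists (N + `|k|%N) => i Ni.
    by exists (absz (k + Posz i)%R); [|congr c]; lia.
  + by move=> i j; rewrite /between !line; lia.
  + apply/seteqP; split=> [_ [i _ <-]|_ [] [i _ <-]].
    * have [ik|ik] : (i <= k)%R \/ (k <= i)%R by lia.
        by left; exists (absz (i - k)%R) => //; congr c; lia.
      by right; exists (absz (i - k)%R) => //; congr c; lia.
    * by exists (k - Posz i)%R.
    * by exists (k + Posz i)%R.
Qed.

(** * Existence of geodesics *)

Lemma segment_from x y : exists c, geodesic_from x (Vertex y) c.
Proof.
have [c [c0 cn seg]] := segment_exists x y.
have /geodesic_fromP[c' h _] : geodesic (Vertex x) (Vertex y)
    [set c i | i in `I_(dist x y).+1] by exists (dist x y), c.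
by exists c'.
Qed.

(** If geodesics from [w] are, at each time [t], eventually at bounded distance
    from a vertex depending only on [t], then they branch finitely by fineness,
    and subconverge to a ray. *)
Lemma limit_ray C w (b : nat -> completion K) (g : nat -> nat -> K) :
  (forall n, geodesic_from w (b n) (g n)) ->
  (forall t : nat, exists N p, forall n, N <= n ->
     dist w (g n t) = t /\ dist p (g n t) <= C) ->
  exists c, [/\ is_ray c, c 0 = w &
    forall k N, exists2 n, N <= n & forall i, i <= k -> c i = g n i].
Proof.
move=> gP close.
have [N HN] := choice close; have [p Hp] := choice HN.
(* The vertex at time [i] is more than [C] before the one at time [t i]. *)
pose t (i : nat) : nat := i + C.+1.
have [||c Hc] := @konig nat K (fun i => w |` on_arc (0 + C + t i) w (p (t i))) g.
- by move=> i; rewrite finite_setU; split; [exact: finite_set1|exact: finite_on_arc].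
- move=> i; exists (N (t i) + N i) => n Nn.
  case: i Nn => [|i] Nn; first by left; exact: geodesic_from0 (gP n).
  right; have [dt pt] := Hp (t i.+1) n ltac:(lia); have [di _] := Hp i.+1 n ltac:(lia).
  have bw := @geodesic_from_between _ _ _ (gP n) 0 i.+1 (t i.+1) ltac:(rewrite /t; lia).
  rewrite (geodesic_from0 (gP n)) in bw.
  rewrite -[X in on_arc (_ + X)]dt; apply: (on_arc_between _ pt bw).
  + by rewrite distxx.
  + by rewrite di.
  + by move: bw; rewrite /between di dt /t; lia.
have agree k M : exists2 n, M <= n & forall i, i <= k -> c i = g n i.
  have [n Mn h] := Hc (iota 0 k.+1) M; exists n => // i ik.
  by apply: h; rewrite mem_iota; lia.
exists c; split => //.
- move=> i j ij; have [n Nn h] := agree j (N i + N j).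
  rewrite !h//; have [di _] := Hp i n ltac:(lia); have [dj _] := Hp j n ltac:(lia).
  have := @geodesic_from_between _ _ _ (gP n) 0 i j ltac:(lia).
  rewrite (geodesic_from0 (gP n)) /between; lia.
- by have [n _ ->] := agree 0 0; rewrite ?(geodesic_from0 (gP n)).
Qed.

Lemma ray_from x xi : exists c, geodesic_from x (Ideal xi) c.
Proof.
have [s sxi] := converges_exists xi.
have far := converges_self sxi x.
have /choice[g gP] : forall n, exists c, geodesic_from x (Vertex (s n)) c.
  by move=> n; exact: segment_from.
have at_ n (t : nat) : t <= dist x (s n) -> dist x (g n t) = t /\ between x (g n t) (s n).
  move=> tn; have [g0 [seg end_]] := gP n.
  have e : g n (dist x (s n)) = s n by exact: end_.
  split; first by rewrite -{1}g0 seg ?subn0.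
  by rewrite -{1}g0 -{1}e; apply: (geodesic_from_between (gP n)); rewrite tn.
have gt_dist (t : nat) N : (forall i j, N <= i -> N <= j -> 2 * t <= gp x (s i) (s j)) ->
    forall n, N <= n -> t <= dist x (s n).
  by move=> HN n Nn; have := HN n n Nn Nn; have := gp_le x (s n) (s n); lia.
have [|c [ray c0 agree]] := @limit_ray (2 * delta) x _ g gP.
  move=> t; have [N HN] := far (2 * t); exists N, (g N t) => n Nn.
  have [dn bn] := at_ n t (gt_dist _ _ HN _ Nn).
  have [dN bN] := at_ N t (gt_dist _ _ HN _ (leqnn N)).
  by split=> //; apply: (fellow_travel bN bn); rewrite ?dn ?dN// HN.
exists c; split=> //; split=> //; apply: (asymptotic_converges sxi).
apply: (@asymptotic_at x) => M.
have [N HN] := far (M + delta); exists (N + M + delta) => m k Nm Nk.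
have [N' HN'] := far (2 * k).
have [n Nn /(_ k (leqnn k)) ->] := agree k (N + N').
have [dk bk] := at_ n k (gt_dist _ _ HN' n ltac:(lia)).
have := HN m n ltac:(lia) ltac:(lia); have := hypK x (s m) (s n) (g n k).
have := gp_dist x (s n) (g n k); move: bk; rewrite /between (distC (s n)); lia.
Qed.

Lemma geodesic_from_exists x b : exists c, geodesic_from x b c.
Proof. by case: b => [y|xi]; [exact: segment_from|exact: ray_from]. Qed.

(** If one product were large, then by hyperbolicity so would be all later ones,
    and the two rays would be asymptotic. *)
Lemma gp_bounded w xi eta (r t : nat -> K) : xi <> eta ->
  geodesic_from w (Ideal xi) r -> geodesic_from w (Ideal eta) t ->
  exists B, forall i j, gp w (r i) (t j) <= B.
Proof.
move=> ne [r0 [rayr rxi]] [t0 [rayt teta]]; apply: contrapT => unb; apply: ne.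
apply: (@converges_unique t) => //; apply: (asymptotic_converges rxi).
apply: (@asymptotic_at w) => M.
have [i0 [j0 big]] : exists i j, M + 2 * delta < gp w (r i) (t j).
  apply: contrapT => nb; apply: unb; exists (M + 2 * delta) => i j.
  by rewrite leqNgt; apply/negP => h; apply: nb; exists i, j.
have out (c : nat -> K) : c 0 = w -> is_ray c -> forall i j, i <= j -> gp w (c i) (c j) = 2 * i.
  move=> c0 ray i j ij; have := gp_dist w (c i) (c j).
  by rewrite -c0 !ray; lia.
exists (i0 + j0) => i j ii jj.
have := hypK w (r i) (r i0) (t j); have := hypK w (r i0) (t j0) (t j).
have := out r r0 rayr i0 i ltac:(lia); have := out t t0 rayt j0 j ltac:(lia).
have := gp_le w (r i0) (t j0); have := gp_le w (t j0) (r i0).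
rewrite (gpC w (t j0) (r i0)) (gpC w (r i) (r i0)).
have := rayr 0 i0 ltac:(lia); have := rayt 0 j0 ltac:(lia); rewrite r0 t0; lia.
Qed.

(** The Gromov product at [w] of the vertices of two rays [r] and [t] is bounded by
    some [B], so the geodesic from [r n] to [t n] follows [r] backwards to the
    neighbourhood of [w], which it reaches at time about [n], and then follows
    [t]. Centred there, these geodesics subconverge to a line. *)
Lemma line_exists xi eta : xi <> eta -> exists S, geodesic (Ideal xi) (Ideal eta) S.
Proof.
move=> ne; have [s _] := converges_exists xi.
pose w := s 0.
have [r rP] := ray_from w xi; have [t tP] := ray_from w eta.
have [B HB] := gp_bounded ne rP tP.
have [r0 [rayr rxi]] := rP; have [t0 [rayt teta]] := tP.
have /choice[g gP] : forall n, exists c, geodesic_from (r n) (Vertex (t n)) c.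
  by move=> n; exact: segment_from.
have dr n : dist w (r n) = n by rewrite -r0 rayr ?subn0.
have dt n : dist w (t n) = n by rewrite -t0 rayt ?subn0.
have dg n : dist (r n) (t n) + gp w (r n) (t n) = 2 * n.
  by have := gp_dist w (r n) (t n); rewrite dr dt; lia.
have seg n i j : i <= j -> j <= 2 * n - B -> dist (g n i) (g n j) = j - i.
  by move=> ij jn; have [_ [-> //]] := gP n; have := dg n; have := HB n n; lia.
have g0 n : g n 0 = r n by have [] := gP n.
have gn n : g n (dist (r n) (t n)) = t n by have [_ [_ ->]] := gP n.
have nearr n i : B <= i -> i + B <= n -> dist (r i) (g n (n - i)) <= 2 * delta.
  move=> Bi iBn; apply: (@fellow_travel (r n) w (t n)).
  - by rewrite /between (distC (r n) w) (distC (r n)) (distC _ w) rayr ?dr; lia.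
  - rewrite -{1}g0 -{1}gn; apply: (geodesic_from_between (gP n)).
    by have := dg n; have := HB n n; lia.
  - by rewrite distC rayr -?g0 ?seg; lia.
  - rewrite (distC (r n) (r i)) rayr; last lia.
    have := gp_dist (r n) w (t n); have := dg n; have := HB n n.
    by rewrite (distC (r n) w) dr dt; lia.
have neart n i : i + B <= n -> dist (t i) (g n (n + i)) <= B + 2 * delta.
  move=> iBn; set q := gp w (r n) (t n); have qB : q <= B := HB n n.
  have dgn := dg n; rewrite -/q in dgn.
  have gti : dist (t n) (g n (n + i)) = n - i - q.
    rewrite distC -{1}gn; have [_ [-> //]] := gP n; lia.
  have := dist_triangle (t (i + q)) (t i) (g n (n + i)); rewrite rayt ?leq_addr//.
  suff : dist (t (i + q)) (g n (n + i)) <= 2 * delta by lia.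
  have dti : dist (t n) (t (i + q)) = n - i - q by rewrite distC rayt; lia.
  apply: (@fellow_travel (t n) w (r n)).
  - by rewrite /between dti (distC (t n)) (distC _ w) !dt; lia.
  - apply: betweenC; rewrite -{1}g0 -{1}gn.
    by apply: (geodesic_from_between (gP n)); lia.
  - by rewrite dti gti.
  - rewrite dti; have := gp_dist (t n) w (r n).
    by rewrite (distC (t n) w) (distC (t n)) dr dt; lia.
(* The margin [a i] places the vertex at time [i] between vertices close to
   [r (a i)] and [t (a i)], and further from them than these are from the rays. *)
pose f n (i : int) := g n (absz (Posz n + i)%R).
pose a (i : int) := absz i + (B + 2 * delta).+1.
have [||c Hc] := @konig int K
  (fun i => on_arc (2 * delta + (B + 2 * delta) + (a i + a i)) (r (a i)) (t (a i))) f.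
- by move=> i; exact: finite_on_arc.
- move=> i; exists (a i + B) => n an.
  have ai : `|i|%N < a i by rewrite /a; lia.
  have ai' : B <= a i by rewrite /a; lia.
  have an' : absz i + (B + 2 * delta).+1 + B <= n := an.
  have L : dist (g n (n - a i)) (g n (n + a i)) = a i + a i by rewrite seg; lia.
  rewrite -[X in on_arc (_ + X)]L.
  have bw : between (g n (n - a i)) (f n i) (g n (n + a i)).
    by apply: (geodesic_from_between (gP n)); lia.
  apply: (on_arc_between _ _ bw).
  + exact: nearr.
  + exact: neart.
  + by rewrite /f seg /a; lia.
  + by rewrite /f seg /a; lia.
have cE i N : exists2 n, N <= n & c i = f n i.
  by have [n Nn h] := Hc [:: i] N; exists n => //; apply: h; rewrite mem_head.
exists (range c), c; split=> //.
- move=> i j ij; have [n Nn h] := Hc [:: i; j] (absz i + absz j + B).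
  by rewrite !h ?inE ?eqxx ?orbT// /f seg; lia.
- apply: (@converges_close (2 * delta) B _ _ _ rxi) => i Bi.
  have [n Nn ->] := cE (- Posz i)%R (i + B).
  have -> : f n (- Posz i)%R = g n (n - i) by congr (g n _); lia.
  exact: nearr.
- apply: (@converges_close (B + 2 * delta) 0 _ _ _ teta) => i Bi.
  have [n Nn ->] := cE (Posz i)%R (i + B).
  have -> : f n (Posz i)%R = g n (n + i) by congr (g n _); lia.
  exact: neart.
Qed.

Lemma geodesic_exists (q r : completion K) : q <> r -> exists S, geodesic q r S.
Proof.
case: q => [x|xi].
  move=> _; have [c h] := geodesic_from_exists x r; exists (range c).
  by apply/geodesic_fromP; exists c.
case: r => [y|eta] ne.
  have [c h] := geodesic_from_exists y (Ideal xi); exists (range c).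
  by apply/geodesicC/geodesic_fromP; exists c.
by apply: line_exists => e; apply: ne; rewrite e.
Qed.

(** * Open sets of the completion *)

Lemma on_arc_le L L' x y : L <= L' -> on_arc L x y `<=` on_arc L' x y.
Proof.
move=> LL z [s [ps ls us sz zs]]; exists s; split=> //; exact: leq_trans LL.
Qed.

Lemma on_arc_dist L x y z : on_arc L x y z -> dist x z <= L.
Proof.
move=> [s [ps ls us sz zs]]; apply: leq_trans sz.
move: ps; case/splitPl: zs => s1 s2 <-; rewrite cat_path size_cat => /andP[p1 _].
by apply: leq_trans (dist_le_walk p1) _; rewrite leq_addr.
Qed.

(** The thin triangle alternative holds at each stage of sequences tending to the
    vertices of an ideal triangle; one side has to be chosen for good. *)
Lemma cofinal_or (P Q : nat -> Prop) :
  (exists N, forall n, N <= n -> P n \/ Q n) ->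
  (forall N, exists2 n, N <= n & P n) \/ (forall N, exists2 n, N <= n & Q n).
Proof.
move=> [N HN]; case: (pselect (forall N, exists2 n, N <= n & P n)); first by left.
move=> /existsNP[N' no]; right => M; exists (N + N' + M); first lia.
case: (HN (N + N' + M) ltac:(lia)) => // h; case: no.
by exists (N + N' + M) => //; lia.
Qed.

Lemma geodesic_from_set x b c : geodesic_from x b c -> geodesic (Vertex x) b (range c).
Proof. by move=> h; apply/geodesic_fromP; exists c. Qed.

Lemma geodesic_from_vertex x y c n :
  geodesic_from x (Vertex y) c -> dist x y <= n -> c n = y.
Proof. by move=> [_ [_ h]] /h. Qed.

Lemma geodesic_nonempty (q r : completion K) S : geodesic q r S -> S !=set0.
Proof.
case: q r => [x|xi] [y|eta] /=.
- by move=> [n [c [_ _ _ ->]]]; exists (c 0), 0.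
- by move=> [c [_ _ _ ->]]; exists (c 0), 0.
- by move=> [c [_ _ _ ->]]; exists (c 0), 0.
- by move=> [c [_ _ _ ->]]; exists (c 0%R), 0%R.
Qed.

Lemma geodesic_point (q r : completion K) S u v k : geodesic q r S -> S u -> S v ->
  k <= dist u v -> exists z, [/\ S z, between u z v & dist u z = k].
Proof.
move=> gS Su; have [c1 [c2 [g1 g2 _ ->]]] := geodesic_split gS Su.
have key b c i : geodesic_from u b c -> k <= dist u (c i) ->
    between u (c k) (c i) /\ dist u (c k) = k.
  move=> gc ki; split; last exact: geodesic_from_at gc _ _ ki.
  have := geodesic_from_between gc (i := 0) (j := k) (k := i).
  rewrite (geodesic_from0 gc); apply.
  by have := geodesic_from_le gc (leq0n i); rewrite (geodesic_from0 gc); lia.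
by move=> [] [i _ <-] ki; [have [? ?] := key _ _ _ g1 ki|have [? ?] := key _ _ _ g2 ki];
  [exists (c1 k)|exists (c2 k)]; split=> //; [left|right]; exists k.
Qed.

Lemma geodesic_through x y z : between x y z ->
  exists2 S, geodesic (Vertex x) (Vertex z) S & S y.
Proof.
move=> b; have [c1 [c10 c1n seg1]] := segment_exists x y.
have [c2 [c20 c2n seg2]] := segment_exists y z.
set k := dist x y in c1n seg1.
pose c i := if i <= k then c1 i else c2 (i - k).
have cy : c k = y by rewrite /c leqnn.
have c0 : c 0 = x by [].
have ce : c (dist x z) = z.
  rewrite /c -b -/k; case: leqP => [kk|_]; last by rewrite addKn.
  have yz : dist y z = 0 by lia.
  by rewrite yz addn0 c1n; exact: dist0_eq yz.
exists [set c i | i in `I_(dist x z).+1]; last first.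
  by exists k => //=; rewrite -b /k; lia.
exists (dist x z), c; split=> //; apply: lazy_segment; last by rewrite c0 ce.
move=> i ilt; rewrite /c; case: (ltngtP i k) => ik.
- by rewrite seg1; lia.
- by rewrite subSn ?seg2 /k; move: b ik; rewrite /between -/k; lia.
- rewrite ik subSn// subnn c1n -c20 seg2; move: b ilt; rewrite /between -/k; lia.
Qed.

(** If a geodesic [c] avoiding [x] has a point close to a geodesic [a] from [x],
    but not too close to [x], then one can travel from the first vertex of [a]
    along [a] and back along [c] without meeting [x]. *)
Lemma first_vertex_on_arc C R x u b (r : completion K) a c i j :
  geodesic_from x b a -> geodesic_from u r c -> (forall k, c k <> x) ->
  i <= R -> dist (c i) (a j) <= C -> C < dist x (c i) ->
  exists2 k, a k <> x & on_arc (dist x u + 2 * R + 2 * C).+1 x u (a k).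
Proof.
move=> ga gc cx iR cia xci.
have a0 := geodesic_from0 ga; have c0 := geodesic_from0 gc.
have := geodesic_from_norm ga j; set m := dist x (a j) => am.
have mpos : 0 < m.
  by have := dist_triangle (a j) x (c i); rewrite (distC (a j)) -/m; lia.
have a1 : dist x (a 1) = 1 by apply: (geodesic_from_at ga (m := j)).
have amj : dist (a 1) (a j) = m - 1.
  have := geodesic_from_between ga (i := 0) (j := 1) (k := m) ltac:(lia).
  by rewrite /between a0 am a1; lia.
pose P := [set z : K | z <> x].
have w1 : walk_in P (a 1) (a j) (m - 1).
  apply: walk_in_sub (eq_leq amj) (geodesic_walk _ _) => z /= bz zx.
  by move: bz; rewrite zx /between (distC (a 1)) a1; lia.
have w2 : walk_in P (a j) (c i) C.
  have aci : dist (a j) (c i) <= C by rewrite distC.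
  apply: walk_in_sub aci (geodesic_walk _ _) => z /= bz zx.
  by move: bz; rewrite zx /between (distC (a j)) -/m (distC (a j)); lia.
have := geodesic_from_norm gc i; set l := dist u (c i) => cl.
have lR : l <= R.
  by have := geodesic_from_le gc (leq0n i); rewrite c0 -/l; lia.
have w3 : walk_in P (c i) u R.
  have := @segment_walk_in l (fun k => c (l - k)); rewrite subn0 subnn cl c0.
  move=> w; apply: walk_in_sub lR (w _) => [_ [k _ <-]|k kl]; first exact: cx.
  have d1 : dist u (c (l - k)) = l - k.
    by apply: (geodesic_from_at gc (m := i)); rewrite -/l; lia.
  have d2 : dist u (c (l - k.+1)) = l - k.+1.
    by apply: (geodesic_from_at gc (m := i)); rewrite -/l; lia.
  have := geodesic_from_between gc (i := 0) (j := l - k.+1) (k := l - k) ltac:(lia).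
  by rewrite c0 /between (distC (c (l - k))) d1 d2; lia.
exists 1; first by move=> e; move: a1; rewrite e distxx.
have := on_arc_first (dist_adj a1) (walk_in_cat (walk_in_cat w1 w2) w3) (fun h => h erefl).
apply: on_arc_le.
have := dist_triangle u x (c i); have := dist_triangle (c i) x (a j).
by rewrite -/m -/l; lia.
Qed.

Lemma near_between x y u v e : between x v y -> dist x v = dist x u ->
  dist x u + dist u y <= dist x y + e -> dist u v <= e + delta.
Proof.
move=> b xvu az; have := hypK x u y v.
have := gp_dist x u y; have := gp_dist x y v; have := gp_dist x u v.
by move: b; rewrite /between (distC y v); lia.
Qed.

(** Thin triangles, for a vertex [x] and arbitrary points [q] and [r]: the
    four-point condition for [x], the vertex [c2 i] and far vertices of [c1] and
    [c2] puts [c2 i] almost between [x] and the latter. *)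
Lemma thin_triangle x u (q r : completion K) c1 c2 a1 a2 i :
  geodesic_from u q c1 -> geodesic_from u r c2 ->
  (forall i j, between (c1 i) u (c2 j)) ->
  geodesic_from x q a1 -> geodesic_from x r a2 ->
  (exists j, dist (c2 i) (a1 j) <= 3 * delta) \/
  (exists j, dist (c2 i) (a2 j) <= 3 * delta).
Proof.
move=> g1 g2 bw h1 h2; set z := c2 i.
have [|az|az] := @cofinal_or
    (fun n => dist x z + dist z (c1 n) <= dist x (c1 n) + delta)
    (fun n => dist x z + dist z (c2 n) <= dist x (c2 n) + delta).
- exists i => n ni; have := four_point x (c1 n) z (c2 n).
  have := geodesic_from_between g2 (i := 0) (j := i) (k := n) ltac:(lia).
  have := bw n n; have := bw n i; rewrite (geodesic_from0 g2) /between -/z.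
  by rewrite (distC (c1 n) z); lia.
- left; have [j jz] := near_geodesic_from h1 (geodesic_from_tends g1) az.
  by exists j; lia.
- right; have [j jz] := near_geodesic_from h2 (geodesic_from_tends g2) az.
  by exists j; lia.
Qed.

(** Follow the geodesic from [u] towards [r] up to time [R]. Either [r] has been
    reached, or the current vertex is far from [x] and, by thinness, close to one
    of the geodesics from [x]; both allow one to come back to the first vertex of
    this geodesic without meeting [x]. The first alternative is kept apart because
    the second one is ruled out when [q] is a vertex and [R] is large. *)
Lemma bounded_angle R x u (q r : completion K) c1 c2 a1 a2 :
  geodesic_from u q c1 -> geodesic_from u r c2 ->
  (forall i j, between (c1 i) u (c2 j)) ->
  geodesic_from x q a1 -> geodesic_from x r a2 ->
  (forall k, c2 k <> x) -> 3 * delta + dist x u < R ->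
  let L := (dist x u + 2 * R + 6 * delta).+1 in
  (exists2 k, a2 k <> x & on_arc L x u (a2 k)) \/
  [/\ dist u (c2 R) = R, exists j, dist (c2 R) (a1 j) <= 3 * delta &
      exists2 k, a1 k <> x & on_arc L x u (a1 k)].
Proof.
move=> g1 g2 bw h1 h2 c2x RR L.
have LE : L = (dist x u + 2 * R + 2 * (3 * delta)).+1 by rewrite /L; lia.
case: (geodesic_from_end g2 R) => [dR|rE]; last first.
  left; have e : a2 (dist x (c2 R)) = c2 R.
    by apply: (geodesic_from_vertex (y := c2 R)) => //; rewrite rE.
  have [||k kx k_on] := @first_vertex_on_arc 0 R _ _ _ _ _ _ R (dist x (c2 R)) h2 g2 c2x (leqnn R).
  - by rewrite e distxx.
  - case E: (dist x (c2 R)) => [|//]; case: (c2x R); exact/esym/dist0_eq.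
  by exists k => //; apply: on_arc_le k_on; rewrite /L; lia.
have far : 3 * delta < dist x (c2 R).
  by have := dist_triangle x u (c2 R); rewrite (distC u x); lia.
case: (thin_triangle R g1 g2 bw h1 h2) => -[j jz].
  right; split; [by []|by exists j|]; rewrite LE.
  exact: first_vertex_on_arc h1 g2 c2x (leqnn R) jz far.
by left; rewrite LE; exact: first_vertex_on_arc h2 g2 c2x (leqnn R) jz far.
Qed.

(** The complement of the shadow of [f] seen from [w]. *)
Definition misses w f : set (completion K) :=
  [set b | forall S, geodesic (Vertex w) b S -> ~ S f].

(** Near a vertex [x]: a geodesic from [w] to [b] through [x] meets [f] after
    [x] or else between [w] and [x], and one avoiding [x] forces the geodesics
    from [x] to [b] to start in a finite set, by the bounded angle property. *)
Lemma misses_near_vertex w f x : f <> w -> misses w f (Vertex x) ->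
  exists2 A : set K, finite_set A & forall b,
    (forall S, geodesic (Vertex x) b S -> forall z, S z -> A z -> Vertex z = Vertex x) ->
    misses w f b.
Proof.
move=> fw mx; case: (pselect (x = w)) => [->|xw].
  exists [set f]; first exact: finite_set1.
  by move=> b bA S gS Sf; case: (bA S gS f Sf erefl) => /fw.
have nb : ~ between w f x by move=> /geodesic_through[S gS]; exact: mx gS.
have fx : f <> x by move=> e; apply: nb; rewrite e /between distxx addn0.
(* A vertex at distance [R] from [w] is not close to a geodesic from [x] to [w]. *)
pose R := (2 * dist x w + 3 * delta).+1.
pose L := (dist x w + 2 * R + 6 * delta).+1.
exists (f |` on_arc L x w).
  by rewrite finite_setU; split; [exact: finite_set1|exact: finite_on_arc].
move=> b bA S gS Sf; case: (pselect (S x)) => Sx.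
  have [c1 [c2 [g1 g2 _ SE]]] := geodesic_split gS Sx.
  move: Sf; rewrite SE => -[] [i _ fE].
    apply: nb; apply: betweenC; rewrite -fE.
    have e := geodesic_from_vertex g1 (leq_addl i (dist x w)).
    have := geodesic_from_between g1 (i := 0) (j := i) (k := i + dist x w) ltac:(lia).
    by rewrite e (geodesic_from0 g1).
  have e : Vertex f = Vertex x by apply: (bA _ (geodesic_from_set g2)); [exists i|left].
  by case: e => /fx.
move/geodesic_fromP: gS => [c2 g2 SE].
have [c1 g1] := segment_from w w; have [a1 h1] := segment_from x w.
have [a2 h2] := geodesic_from_exists x b.
have [i j|k kx||[k kx k_on]|[dR [j jz] _]] := @bounded_angle R x w _ _ c1 c2 a1 a2 g1 g2 _ h1 h2.
- by rewrite (geodesic_from_vertex g1) ?distxx// /between distxx.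
- by apply: Sx; rewrite SE -kx; exists k.
- by rewrite /R; lia.
- have e : Vertex (a2 k) = Vertex x.
    by apply: (bA _ (geodesic_from_set h2)); [exists k|right].
  by case: e => /kx.
- have e := geodesic_from_vertex h1 (leq_addl j (dist x w)).
  have := geodesic_from_between h1 (i := 0) (j := j) (k := j + dist x w) ltac:(lia).
  rewrite e (geodesic_from0 h1) /between.
  have := dist_triangle x w (c2 R); have := dist_triangle (a1 j) x (c2 R).
  have RE : R = (2 * dist x w + 3 * delta).+1 by [].
  by rewrite (distC w x) (distC (a1 j) (c2 R)) dR; lia.
Qed.

(** The four-point condition for [r m], [w] and far vertices of the two halves of
    [S] puts [r m] almost between [w] and far vertices on the side of [b], or
    almost between two vertices of [S]. *)
Lemma thin_ideal_triangle w xi b r g S m :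
  geodesic_from w (Ideal xi) r -> geodesic_from w b g -> geodesic (Ideal xi) b S ->
  (exists j, dist (r m) (g j) <= 4 * delta) \/
  (exists2 v, S v & dist (r m) v <= 4 * delta).
Proof.
move=> gr gg gS; have [v0 Sv0] := geodesic_nonempty gS.
have [c1 [c2 [g1 g2 bw SE]]] := geodesic_split gS Sv0.
have [r0 [ray rxi]] := gr.
have dr i : dist w (r i) = i by rewrite -r0 ray ?subn0.
have [N HN] := tends_to_agree w (2 * m) (geodesic_from_tends gr) (geodesic_from_tends g1).
have toward n : N <= n -> dist w (r m) + dist (r m) (c1 n) <= dist w (c1 n) + delta.
  move=> Nn; have := HN (N + m) n ltac:(lia) Nn.
  have := hypK w (r m) (r (N + m)) (c1 n); rewrite !dr.
  have := gp_dist w (r m) (r (N + m)); have := gp_dist w (r m) (c1 n).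
  by rewrite ray ?dr; lia.
have [|az|az] := @cofinal_or
    (fun n => dist (c1 n) (r m) + dist (r m) (c2 n) <= dist (c1 n) (c2 n) + 2 * delta)
    (fun n => dist w (r m) + dist (r m) (c2 n) <= dist w (c2 n) + 2 * delta).
- exists N => n Nn; have := toward n Nn; have := four_point (r m) w (c2 n) (c1 n).
  rewrite (distC (r m) w) (distC (c2 n) (c1 n)) (distC (c1 n) (r m)); lia.
- right; have [n _ close] := az 0.
  have S1 : S (c1 n) by rewrite SE; left; exists n.
  have S2 : S (c2 n) by rewrite SE; right; exists n.
  case: (leqP (dist (c1 n) (r m)) (dist (c1 n) (c2 n))) => h.
    have [v [Sv bv dv]] := geodesic_point gS S1 S2 h.
    by exists v => //; have := near_between bv dv close; lia.
  by exists (c2 n) => //; lia.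
- left; have [j jz] := near_geodesic_from gg (geodesic_from_tends g2) az.
  by exists j; lia.
Qed.

(** Near an ideal point [xi], with a ray [r] from [w] to [xi]: if geodesics from
    [w] through [f] ended at points [b] arbitrarily close to [xi], they would
    follow [r] for longer and longer times, since a geodesic from [xi] to [b]
    following two distant vertices of [r] would meet a finite set of arcs
    between these. They would then subconverge to a ray from [w] to [xi] through [f]. *)
Lemma misses_near_ideal w f xi : misses w f (Ideal xi) ->
  exists2 A : set K, finite_set A & forall b,
    (forall S, geodesic (Ideal xi) b S -> forall z, S z -> A z -> Vertex z = Ideal xi) ->
    misses w f b.
Proof.
move=> mxi; apply: contrapT => noA.
have [r gr] := ray_from w xi; have [r0 [ray rxi]] := gr.
have dr i : dist w (r i) = i by rewrite -r0 ray ?subn0.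
(* A geodesic passing within [4 * delta] of [r n] and [r (n + k)] has a vertex in
   between at a larger distance from the vertices where it does so. *)
pose k := (16 * delta).+2; pose L := 16 * delta + k.
have /choice[bg bgP] : forall n, exists bg : completion K * (nat -> K),
    [/\ geodesic_from w bg.1 bg.2, exists j, bg.2 j = f &
        forall S, geodesic (Ideal xi) bg.1 S ->
        forall z, S z -> ~ on_arc L (r n) (r (n + k)) z].
  move=> n; apply: contrapT => no; apply: noA.
  exists (on_arc L (r n) (r (n + k))); first exact: finite_on_arc.
  move=> b bA S gS Sf; apply: no; move/geodesic_fromP: gS Sf => [g gg ->] [j _ jf].
  exists (b, g); split=> //; first by exists j.
  by move=> S' gS' z S'z zon; have := bA S' gS' z S'z zon.
have close n (t : nat) : t + 4 * delta <= n ->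
    dist w ((bg n).2 t) = t /\ dist (r t) ((bg n).2 t) <= 2 * delta.
  move=> tn; have [gg [j0 j0f] avoid] := bgP n; set b := (bg n).1 in gg avoid.
  set g := (bg n).2 in gg j0f *.
  have bxi : Ideal xi <> b.
    move=> e; rewrite -e in gg; apply: (mxi _ (geodesic_from_set gg)).
    by exists j0.
  have [S gS] := geodesic_exists bxi.
  have [n' [j [nn' jz]]] : exists n' j, n <= n' /\ dist (r n') (g j) <= 4 * delta.
    case: (thin_ideal_triangle n gr gg gS) => [[j jz]|[v1 Sv1 v1r]]; first by exists n, j.
    case: (thin_ideal_triangle (n + k) gr gg gS) => [[j jz]|[v2 Sv2 v2r]].
      by exists (n + k), j; split=> //; lia.
    have rnk : dist (r n) (r (n + k)) = k by rewrite ray; lia.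
    have t1 := dist_triangle v1 (r n) (r (n + k)).
    have t2 := dist_triangle v2 v1 (r (n + k)).
    have t3 := dist_triangle (r n) v1 v2.
    have t4 := dist_triangle (r (n + k)) (r n) v2.
    rewrite (distC v1 (r n)) in t3; rewrite (distC v2 (r (n + k))) in t2.
    have kE : k = (16 * delta).+2 by [].
    have [|z [Sz bz dz]] := @geodesic_point _ _ S v1 v2 (4 * delta).+1 gS Sv1 Sv2.
      by lia.
    case: (avoid S gS z Sz); apply: on_arc_le (on_arc_between v1r v2r bz _ _).
    - by rewrite /L; lia.
    - by rewrite dz.
    - by move: bz; rewrite /between dz; lia.
  have t1 := dist_triangle (g j) w (r n'); rewrite dr (distC (g j)) in t1.
  have tj : t <= dist w (g j) by lia.
  have dt := geodesic_from_at gg tj; split=> //.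
  have jle := geodesic_from_le gg (leq0n j); rewrite (geodesic_from0 gg) in jle.
  apply: (@fellow_travel w (r n') (g j)).
  - by rewrite /between !dr ray; lia.
  - have := geodesic_from_between gg (i := 0) (j := t) (k := j) ltac:(lia).
    by rewrite (geodesic_from0 gg).
  - by rewrite dr dt.
  - by have := gp_dist w (r n') (g j); rewrite !dr; lia.
have [||c [cray c0 cE]] := @limit_ray (2 * delta) w (fun n => (bg n).1) (fun n => (bg n).2).
- by move=> n; have [] := bgP n.
- by move=> t; exists (t + 4 * delta), (r t) => n tn; exact: close.
have gc : geodesic_from w (Ideal xi) c.
  split=> //; split=> //; apply: (@converges_close (2 * delta) 0 _ _ _ rxi) => i _.
  have [n ni /(_ i (leqnn i)) ->] := cE i (i + 4 * delta).
  by have [] := close n i ni.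
apply: (mxi _ (geodesic_from_set gc)); exists (dist w f) => //.
have [n _ /(_ _ (leqnn _)) ->] := cE (dist w f) 0.
by have [gg [j <-] _] := bgP n; exact: geodesic_from_norm gg j.
Qed.

Lemma misses_open w f : f <> w -> completion_open (misses w f).
Proof.
move=> fw [x|xi] m; first exact: misses_near_vertex.
exact: misses_near_ideal.
Qed.

(** * Neighbourhoods avoided by geodesics *)

Lemma completion_open_bigI (A : set K) (W : K -> set (completion K)) : finite_set A ->
  (forall f, A f -> completion_open (W f)) -> completion_open (\bigcap_(f in A) W f).
Proof.
move=> /finite_seqP[l ->]; elim: l => [|f l IH] oW.
  have -> : \bigcap_(h in [set` [::]]) W h = setT by apply/seteqP; split.
  exact: completion_openT.
have -> : \bigcap_(h in [set` f :: l]) W h = W f `&` \bigcap_(h in [set` l]) W h.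
  apply/seteqP; split=> [b Wb|b [Wf Wb] h].
    by split=> [|h hl]; apply: Wb; rewrite /= inE ?eqxx ?hl ?orbT.
  by rewrite /= inE => /orP[/eqP ->|]; [|exact: Wb].
apply: completion_openI; first by apply: oW; rewrite /= mem_head.
by apply: IH => h hl; apply: oW; rewrite /= inE hl orbT.
Qed.

(** If [q] and [r] are seen from [x] away from the finitely many vertices on
    short arcs from [x] to [u], then a geodesic between them through [u] cannot
    contain [x], for then [u] is on such an arc, nor avoid it, by the bounded
    angle property. *)
Lemma vertex_nbhd x u : u <> x -> exists W, [/\ completion_open W, W (Vertex x) &
  forall (q r : completion K) S, W q -> W r -> geodesic q r S -> ~ S u].
Proof.
move=> ux; pose R := (3 * delta + dist x u).+1.
pose L := (dist x u + 2 * R + 6 * delta).+1.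
pose A := on_arc L x u `\ x.
exists (\bigcap_(f in A) misses x f); split.
- apply: completion_open_bigI => [|f [_ fx]]; last exact: misses_open.
  by apply: sub_finite_set (finite_on_arc L x u) => z [].
- move=> f [_ fx] S /geodesic_fromP[c gc ->] [i _ ci]; apply: fx; rewrite /= -ci.
  by apply: (geodesic_from_vertex gc); rewrite distxx.
move=> q r S Wq Wr gS Su.
have unseen b c z : (\bigcap_(f in A) misses x f) b -> geodesic_from x b c ->
    range c z -> ~ A z.
  by move=> Wb gc cz Az; exact: (Wb z Az _ (geodesic_from_set gc)).
case: (pselect (S x)) => Sx.
  have Au : A u by split=> //; apply: on_arc_last; rewrite /L; lia.
  have [c1 [c2 [g1 g2 _ SE]]] := geodesic_split gS Sx.
  by move: Su; rewrite SE => -[cu|cu]; [exact: unseen Wq g1 cu Au|exact: unseen Wr g2 cu Au].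
have [c1 [c2 [g1 g2 bw SE]]] := geodesic_split gS Su.
have [a1 h1] := geodesic_from_exists x q; have [a2 h2] := geodesic_from_exists x r.
have [k kx||[k kx k_on]|[_ _ [k kx k_on]]] := @bounded_angle R x u _ _ c1 c2 a1 a2 g1 g2 bw h1 h2.
- by apply: Sx; rewrite SE -kx; right; exists k.
- by rewrite /R.
- by apply: unseen Wr h2 _ (conj k_on kx); exists k.
- by apply: unseen Wq h1 _ (conj k_on kx); exists k.
Qed.

(** Let [r] be a ray from [u] to [xi], and [x] a vertex on it far from [u]. If a
    geodesic between [p] and [q] contains [u], then one of the geodesics from [x]
    to [p] and [q] follows [r] back to [u], hence meets an arc in a finite set
    that depends only on the beginning of [r], so that [x] can be chosen far
    from it. *)
Lemma ideal_nbhd xi u : exists W, [/\ completion_open W, W (Ideal xi) &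
  forall (p q : completion K) S, W p -> W q -> geodesic p q S -> ~ S u].
Proof.
have [r gr] := ray_from u xi; have [r0 [ray rxi]] := gr.
have dr i : dist u (r i) = i by rewrite -r0 ray ?subn0.
(* As vertices of short arcs from [u] are within [L] of [u], geodesics from [x] to
   [xi], which stay at distance at least [m - delta] from [u], miss them. *)
pose k := (12 * delta).+2; pose L := 12 * delta + k; pose m := (L + delta).+1.
pose A := on_arc L u (r k); pose x := r m.
have kE : k = (12 * delta).+2 by [].
have LE : L = 12 * delta + k by [].
have mE : m = (L + delta).+1 by [].
have dx i : i <= m -> dist x (r i) = m - i by move=> im; rewrite distC ray.
have dxu : dist x u = m by rewrite -r0 dx ?subn0.
exists (\bigcap_(f in A) misses x f); split.
- apply: completion_open_bigI => [|f Af]; first exact: finite_on_arc.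
  by apply: misses_open => fx; have := on_arc_dist Af; rewrite fx distC dxu; lia.
- move=> f Af S /geodesic_fromP[g gg ->] [i _ gi].
  have := on_arc_dist Af; rewrite -gi; apply/negP; rewrite -ltnNge.
  have [N HN] := tends_to_agree x (2 * dist x (g i)) (geodesic_from_tends gg) rxi.
  have := HN (N + i) (N + m) ltac:(lia) ltac:(lia).
  have := geodesic_from_between gg (i := 0) (j := i) (k := N + i) ltac:(lia).
  rewrite (geodesic_from0 gg) /between => b1.
  have b2 : dist x (r (N + m)) = N by rewrite ray; lia.
  have b3 := dr (N + m).
  have := hypK x (g i) (g (N + i)) (r (N + m)); have := hypK x u (g i) (r (N + m)).
  have := gp_dist x u (r (N + m)); have := gp_dist x u (g i).
  have := gp_dist x (g i) (g (N + i)); have := gp_dist x (g i) (r (N + m)).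
  have := gp_le x (g i) u; rewrite (gpC x (g i) u).
  by rewrite dxu; lia.
move=> p q S Wp Wq gS Su.
have [c1 [c2 [g1 g2 bw SE]]] := geodesic_split gS Su.
(* If [u] lies almost between [x] and [b], then so do all vertices of the ray
   between [u] and [x], in particular [r k]. *)
have caught b c s : (\bigcap_(f in A) misses x f) b -> geodesic_from x b c ->
    tends_to b s ->
    (forall N, exists2 n, N <= n & dist x u + dist u (s n) <= dist x (s n) + delta) ->
    False.
  move=> Wb gc sb az.
  have near i : i <= m -> exists j, dist (r i) (c j) <= 3 * delta.
    move=> im; have [|j jz] := near_geodesic_from gc (z := r i) (e := delta) sb.
      move=> N; have [n Nn h] := az N; exists n => //.
      have := dist_triangle u (r i) (s n); rewrite (distC (r i) u) dr dx//.
      by rewrite dxu in h; lia.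
    by exists j; lia.
  have [j1 n1] := near 0 isT; rewrite r0 in n1.
  have [j2 n2] := near k ltac:(lia).
  have t1 := dist_triangle (c j1) u (r k); rewrite dr in t1.
  have t2 := dist_triangle (c j2) (c j1) (r k); rewrite (distC (c j2) (r k)) in t2.
  have t3 := dist_triangle u (c j1) (c j2); rewrite (distC (c j1) u) in t3.
  have t4 := dist_triangle (r k) u (c j2); rewrite dr in t4.
  have [|||z [cz bz dz]] := @geodesic_point _ _ (range c) (c j1) (c j2) (3 * delta).+1
    (geodesic_from_set gc).
  - by exists j1.
  - by exists j2.
  - lia.
  have Az : A z.
    apply: on_arc_le (on_arc_between n1 n2 bz _ _).
    - by lia.
    - by rewrite dz.
    - by move: bz; rewrite /between dz; lia.
  exact: (Wb z Az _ (geodesic_from_set gc)).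
have [a1 h1] := geodesic_from_exists x p; have [a2 h2] := geodesic_from_exists x q.
have [|az|az] := @cofinal_or
    (fun n => dist x u + dist u (c1 n) <= dist x (c1 n) + delta)
    (fun n => dist x u + dist u (c2 n) <= dist x (c2 n) + delta).
- exists 0 => n _; have := four_point x (c1 n) u (c2 n); have := bw n n.
  by rewrite /between (distC u (c1 n)); lia.
- exact: caught Wp h1 (geodesic_from_tends g1) az.
- exact: caught Wq h2 (geodesic_from_tends g2) az.
Qed.

(** A vertex of infinite valence may well lie on all the geodesics between nearby
    points. An edge, however, has a second vertex, which they avoid. *)
Lemma edge_nbhd (e : set K) b : edges e -> exists W, [/\ completion_open W, W b &
  forall (q r : completion K) S, W q -> W r -> geodesic q r S -> ~ e `<=` S].
Proof.
move=> [x [y [xy ->]]]; case: b => [v|xi].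
  have [u [uxy uv]] : exists u, [set x; y] u /\ u <> v.
    case: (pselect (x = v)) => [<-|xv]; last by exists x; split=> //; left.
    by exists y; split; [right|move=> yx; move: xy; rewrite yx adj_irr].
  have [W [oW Wv HW]] := vertex_nbhd uv; exists W; split=> // q r S Wq Wr gS eS.
  exact: HW Wq Wr gS (eS u uxy).
have [W [oW Wv HW]] := ideal_nbhd xi x; exists W; split=> // q r S Wq Wr gS eS.
by apply: HW Wq Wr gS (eS x _); left.
Qed.

Lemma edges_nbhd (E : set (set K)) b : finite_set E -> E `<=` @edges K ->
  exists W, [/\ completion_open W, W b &
    forall (q r : completion K) S e, W q -> W r -> geodesic q r S -> E e -> ~ e `<=` S].
Proof.
move=> /finite_seqP[l ->]; elim: l => [|e l IH] El.
  by exists setT; split=> //; exact: completion_openT.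
have [|W [oW Wb HW]] := IH; first by move=> e' e'l; apply: El; rewrite /= inE e'l orbT.
have [|W' [oW' Wb' HW']] := @edge_nbhd e b; first by apply: El; rewrite /= mem_head.
exists (W `&` W'); split=> //; first exact: completion_openI.
move=> q r S e' [Wq Wq'] [Wr Wr'] gS; rewrite /= inE => /orP[/eqP ->|].
  exact: HW' gS.
exact: HW gS.
Qed.

Lemma geodesic_edge (q r : completion K) : q <> r ->
  exists2 S, geodesic q r S & exists2 e, edges e & e `<=` S.
Proof.
move=> qr; have [S gS] := geodesic_exists qr; exists S => //.
have [u Su] := geodesic_nonempty gS.
have [c1 [c2 [g1 g2 _ SE]]] := geodesic_split gS Su.
have key b c : geodesic_from u b c -> Vertex u <> b -> adj u (c 1).
  move=> gc ub; apply: dist_adj; case: (geodesic_from_end gc 1) => // cb.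
  have := geodesic_from_le gc (leq0n 1); rewrite (geodesic_from0 gc).
  by case E: (dist u (c 1)) => [|[]] // _; case: ub; rewrite (dist0_eq E).
have [v uv Sv] : exists2 v, adj u v & S v.
  case: (pselect (Vertex u = q)) => uq.
    exists (c2 1); last by rewrite SE; right; exists 1.
    by apply: key g2 _; rewrite uq.
  exists (c1 1); last by rewrite SE; left; exists 1.
  exact: key g1 uq.
by exists [set u; v]; [exists u, v|move=> _ [] ->].
Qed.

End FineHyperbolicGraph.

(** * The action on the boundary *)

Section Action.
Variables (Gam : groupType) (K : graph) (a : graph_action Gam K).

Lemma geodesic_act g (q r : completion K) S : geodesic q r S ->
  geodesic (completion_act a g q) (completion_act a g r) (a g @` S).
Proof.
have conv (s : nat -> K) xi : converges_to s xi -> converges_to (a g \o s) (ideal_act a g xi).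
  by move=> sxi; exists s.
case: q r => [x|xi] [y|eta] /=.
- move=> [n [c [seg <- <- ->]]]; exists n, (a g \o c); split=> //.
    by move=> i j ij /=; rewrite dist_act seg.
  by rewrite image_comp.
- move=> [c [ray <- cxi ->]]; exists (a g \o c); split=> //.
  + by move=> i j ij /=; rewrite dist_act ray.
  + exact: conv.
  + by rewrite image_comp.
- move=> [c [ray <- cxi ->]]; exists (a g \o c); split=> //.
  + by move=> i j ij /=; rewrite dist_act ray.
  + exact: conv.
  + by rewrite image_comp.
- move=> [c [line cxi ceta ->]]; exists (a g \o c); split=> //.
  + by move=> i j ij /=; rewrite dist_act line.
  + exact: (conv _ _ cxi).
  + exact: (conv _ _ ceta).
  + by rewrite image_comp.
Qed.

Lemma edge_representatives : finite_set (edge_orbit a @` @edges K) ->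
  exists E : set (set K), [/\ finite_set E, E `<=` @edges K &
    forall e, edges e -> exists g, exists2 e', E e' & e = a g @` e'].
Proof.
move=> fin.
have /choice[rep repP] : forall O : set (set K), exists e : set K,
    (edge_orbit a @` @edges K) O -> edges e /\ edge_orbit a e = O.
  move=> O; case: (pselect ((edge_orbit a @` @edges K) O)) => [[e ee <-]|no].
    by exists e.
  by exists set0 => /no.
exists (rep @` (edge_orbit a @` @edges K)); split.
- exact: finite_image.
- by move=> _ [O oO <-]; have [] := repP O oO.
move=> e ee; have oe : (edge_orbit a @` @edges K) (edge_orbit a e) by exists e.
have [_ E] := repP _ oe.
have : edge_orbit a e e.
  exists 1%g => //; apply/seteqP; split=> [_ [x ex <-]|x ex]; first by rewrite act1.
  by exists x => //; rewrite act1.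
rewrite -E => -[g _ gE]; by exists g, (rep (edge_orbit a e)) => //; exists (edge_orbit a e).
Qed.

End Action.

Theorem proposition3p18 (Gam : groupType) (G : set (set Gam))
    (Grelhyp : relatively_hyperbolic G) (K : graph)
    (a : graph_action Gam K) (Kassoc : associated_graph a G) :
  expansive (boundary_action a).
Proof.
case: Kassoc => -[connK [delta hypK] fineK] [_ finE _ _].
have [E [Efin Eedges Erep]] := edge_representatives finE.
pose val_ : bowditch_boundary K -> completion K := set_val.
pose U : set (bowditch_boundary K * bowditch_boundary K) :=
  [set p | forall S e, geodesic (val_ p.1) (val_ p.2) S -> E e -> ~ e `<=` S].
have nbhsU (p : bowditch_boundary K) : nbhs (p, p) U.
  have [W [oW Wp HW]] := edges_nbhd connK fineK hypK (val_ p) Efin Eedges.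
  have nW : nbhs p (val_ @^-1` W).
    by apply: open_nbhs_nbhs; split=> //; exists W.
  exists (val_ @^-1` W, val_ @^-1` W) => // -[q r] /= [Wq Wr] S e.
  exact: HW Wq Wr.
exists U; first by move=> [p q] /= pq; rewrite /diagonal /= in pq; rewrite pq.
apply/seteqP; split=> [[p q] /= pq g _|[p q] pqU].
  rewrite /diagonal /= in pq; rewrite -pq.
  exists (boundary_act a g^-1%g p, boundary_act a g^-1%g p).
    exact: nbhs_singleton.
  by rewrite /diag_act /= -boundary_actM mulgV boundary_act1.
apply: contrapT => pq.
have vpq : val_ p <> val_ q by move=> e; apply: pq; exact: val_inj.
have [S gS [e ee eS]] := geodesic_edge connK fineK hypK vpq.
have [g [e' Ee' eE]] := Erep e ee.
have [[p' q'] p'q'U [pE qE]] := pqU g Logic.I.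
have back z' z : boundary_act a g z' = z ->
    completion_act a g^-1%g (val_ z) = val_ z'.
  by move=> <-; rewrite /val_ /= -completion_actM mulVg completion_act1.
have := geodesic_act a g^-1%g gS; rewrite (back _ _ pE) (back _ _ qE) => gS'.
apply: (p'q'U _ e' gS' Ee') => x e'x.
exists (a g x); last by rewrite actVK.
by apply: eS; rewrite eE; exists x.
Qed.
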